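(* In the ring of formal power series $\mathbb{C}[[\underline s,\underline t]]$ in the indeterminates $\underline s=(s_i)_{i\ge1}$ and $\underline t=(t_j)_{j\ge 1}$, \[ \sum_{n \ge 0} \sum_{\lambda \vdash n} \sum_{\nu \vdash n} \psi_{S_n}^\lambda(\nu)\, \frac{\underline s^{c(\lambda)} \underline t^{c(\nu)}}{|Z_\nu|} = \exp \left( \sum_{i\ge1} \sum_{j\ge1} \sum_{e \mid \gcd(i,j)} \mu(e)\, \frac{s_{i}^{j/e} t_{j}^{i/e}}{ij/e} \right), \] where $\mu(\cdot)$ is the classical Möbius function.
   Context: For $\lambda\vdash n$ with $a_i$ parts of size $i$ and $\nu\vdash n$ with $b_j$ parts of size $j$, $\underline s^{c(\lambda)} := \prod_i s_i^{a_i}$ and $\underline t^{c(\nu)} := \prod_j t_j^{b_j}$. $|Z_\nu|=\prod_j b_j!\,j^{b_j}$ is the size of the centralizer in $S_n$ of an element of cycle type $\nu$. $\psi(\nu)$ denotes the value of the character $\psi$ on elements of cycle type $\nu$. The $n=0$ term of the sum equals $1$. Higher Lie characters of $S_n$: let $\lambda \vdash n$ have $a_i$ parts of size $i$ ($i\ge 1$), and let $x \in S_n$ have cycle type $\lambda$. Write $x=\prod_i x_i$ where $x_i$ is the product of the $a_i$ cycles of $x$ of length $i$. The centralizer is $Z_x = Z_{S_n}(x) = \prod_i Z_{S_{ia_i}}(x_i) \cong \prod_i G_i \wr S_{a_i}$, with $G_i$ cyclic of order $i$. Concretely, label the $ia_i$ points lying in cycles of length $i$ by $(r,t)$, $1\le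 r\le a_i$, $t \in \mathbb{Z}/i\mathbb{Z}$, so that $x(r,t)=(r,t+1)$; every element $z_i\in Z_{S_{ia_i}}(x_i)$ has the form $z_i(r,t)=(\sigma(r),t+k_r)$ with $\sigma\in S_{a_i}$, $k_r\in\mathbb{Z}/i\mathbb{Z}$. Let $\omega_i$ be the linear character that is a primitive (faithful) irreducible character on the cyclic group $G_i$ and trivial on $S_{a_i}$, i.e. $\omega_i(z_i)=\prod_r \zeta_i^{k_r}$ with $\zeta_i$ a primitive complex $i$-th root of unity. Let $\omega^x := \bigotimes_i \omega_i$, a linear character of $Z_x$. The higher Lie character is the induced character $\psi_{S_n}^\lambda = \psi_{S_n}^x := \omega^x\uparrow_{Z_x}^{S_n}$; it depends only on $\lambda$. *)

(* Defs.v *)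
From HB Require Import structures.
From mathcomp Require Import boolp classical_sets functions cardinality fsbigop.
From mathcomp Require Import all_boot all_order all_algebra all_fingroup.
From mathcomp Require Import all_solvable all_field all_character.
From mathcomp Require Import finmap monalg.

Set Implicit Arguments.
Unset Strict Implicit.
Unset Printing Implicit Defensive.

Import GRing.Theory Num.Theory.
Local Open Scope ring_scope.

(* R[[X]] for an arbitrary set X of indeterminates: arbitrary functions on the
   free commutative monoid {cmonom X} of monomials. *)
Record fps (X : choiceType) (R : Type) : Type :=
  FPS { fcoef :> {cmonom X} -> R }.

HB.instance Definition _ (X : choiceType) (R : Type) := gen_eqMixin (fps X R).
HB.instance Definition _ (X : choiceType) (R : Type) :=
  gen_choiceMixin (fps X R).

Lemma fpsP (X : choiceType) (R : Type) (f g : fps X R) : f =1 g -> f = g.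
Proof. by case: f g => [f] [g] fg; congr FPS; apply/funext. Qed.

Section PowerSeriesRing.
Context {X : choiceType} {R : comNzRingType}.
Implicit Types (f g h : fps X R) (m a b c : {cmonom X}).

Definition fps_zero : fps X R := FPS (fun _ => 0).
Definition fps_opp f : fps X R := FPS (fun m => - f m).
Definition fps_add f g : fps X R := FPS (fun m => f m + g m).
Definition fps_scale (r : R) f : fps X R := FPS (fun m => r * f m).

(* The set of (a, b) with a * b = m is finite, so the default value of the
   finitely supported sum is never used here. *)
Definition fps_mul f g : fps X R := FPS (fun m =>
  \sum_(p \in [set p : {cmonom X} * {cmonom X} | mmul p.1 p.2 = m]%classic)
    f p.1 * g p.2).

Definition fps_monom a : fps X R := FPS (fun m => (m == a)%:R).
Definition fps_var (v : X) : fps X R := fps_monom (ucm v).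

Fact fps_addA : associative fps_add.
Proof. by move=> f g h; apply/fpsP => m /=; rewrite addrA. Qed.
Fact fps_addC : commutative fps_add.
Proof. by move=> f g; apply/fpsP => m /=; rewrite addrC. Qed.
Fact fps_add0 : left_id fps_zero fps_add.
Proof. by move=> f; apply/fpsP => m /=; rewrite add0r. Qed.
Fact fps_addN : left_inverse fps_zero fps_opp fps_add.
Proof. by move=> f; apply/fpsP => m /=; rewrite addNr. Qed.
HB.instance Definition _ :=
  GRing.isZmodule.Build (fps X R) fps_addA fps_addC fps_add0 fps_addN.

Fact fps_scaleA r s f : fps_scale r (fps_scale s f) = fps_scale (r * s) f.
Proof. by apply/fpsP => m /=; rewrite mulrA. Qed.
Fact fps_scale1 : left_id 1 fps_scale.
Proof. by move=> f; apply/fpsP => m /=; rewrite mul1r. Qed.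
Fact fps_scaleDr : right_distributive fps_scale +%R.
Proof. by move=> r f g; apply/fpsP => m /=; rewrite mulrDr. Qed.
Fact fps_scaleDl f : {morph fps_scale^~ f : r s / r + s}.
Proof. by move=> r s; apply/fpsP => m /=; rewrite mulrDl. Qed.
HB.instance Definition _ := GRing.Zmodule_isLmodule.Build R (fps X R)
  fps_scaleA fps_scale1 fps_scaleDr fps_scaleDl.

Let box m : {fset {cmonom X}} :=
  [fset [cmonom (u i : nat) | i : finsupp m]%M
     | u : {ffun finsupp m -> 'I_(mdeg m).+1} in predT]%fset.

Let mem_box a b : a \in box (mmul a b).
Proof.
set m := mmul a b.
have lea i : (a i < (mdeg m).+1)%N.
  rewrite ltnS (leq_trans (leq_addr (b i) _)) // -cmM -/m mdegE.
  have [mi|] := mdomP m i; last by [].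
  by rewrite (big_fsetD1 i) //= leq_addr.
apply/imfsetP; exists [ffun i => Ordinal (lea (val i))] => //.
apply/eqP/cmP => i; rewrite cmE fsfun_ffun.
case: insubP => /= [u _ <-|]; first by rewrite ffunE.
by rewrite -cmE_eq0 cmM addn_eq0 => /andP[/eqP].
Qed.

Let mulE (D : {fset {cmonom X}}) f g m :
  (forall a b, mmul a b = m -> a \in D) ->
  fps_mul f g m = \sum_(a <- D) \sum_(b <- D) (f a * g b) *+ (mmul a b == m).
Proof.
move=> Dm; pose r := [seq (a, b) | a <- D, b <- D].
have r_uniq : uniq r.
  by apply: allpairs_uniq => [||[? ?] [? ?]] //; apply: fset_uniq.
pose P := [pred p : {cmonom X} * {cmonom X} | mmul p.1 p.2 == m].
have rP p : P p -> p \notin r -> f p.1 * g p.2 = 0.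
  case: p => a b /eqP /= abm; case/negP; apply/allpairsP; exists (a, b).
  by rewrite /= (Dm _ _ abm) (Dm b a) // mulmC.
rewrite /= (@eq_fsbigl _ _ _ _ _ _ [set` P]%classic); last first.
  by apply/seteqP; split=> p /= /eqP.
rewrite -(bigfs _ r_uniq rP) big_mkcond big_allpairs_dep /=.
by do 2![apply: eq_bigr => ? _]; rewrite mulrb.
Qed.

Let big_delta (D : {fset {cmonom X}}) (P : pred {cmonom X}) F c :
  (P c -> c \in D) ->
  \sum_(b <- D) (F b *+ (c == b)) *+ P b = F c *+ P c :> R.
Proof.
move=> Pc; have [cD|cD] := boolP (c \in D).
  rewrite (bigD1_seq c) ?fset_uniq //= eqxx big1 ?addr0 // => b.
  by rewrite eq_sym => /negPf ->; rewrite mul0rn.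
rewrite big_seq big1 => [|b bD].
  by case: (P c) Pc cD => [->|].
by case: eqP cD => [->|]; rewrite ?bD // mul0rn.
Qed.

Fact fps_mulC : commutative fps_mul.
Proof.
move=> f g; apply/fpsP => m.
rewrite !(@mulE (box m)); try by move=> a b <-.
rewrite exchange_big; do 2![apply: eq_bigr => ? _].
by rewrite mulrC mulmC.
Qed.

Fact fps_mulDl : left_distributive fps_mul fps_add.
Proof.
move=> f g h; apply/fpsP => m.
transitivity (fps_mul f h m + fps_mul g h m); last by [].
rewrite !(@mulE (box m)); try by move=> a b <-.
rewrite -big_split; apply: eq_bigr => a _; rewrite -big_split.
by apply: eq_bigr => b _; rewrite /= -mulrnDl -mulrDl.
Qed.

Fact fps_mul1 : left_id (fps_monom mone) fps_mul.
Proof.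
move=> f; apply/fpsP => m; rewrite (@mulE (box m)); last by move=> a b <-.
have mm : m \in box m by have := mem_box m mone; rewrite mulm1.
rewrite exchange_big -[RHS]mulr1n.
rewrite -(@big_delta (box m) xpredT f m (fun=> mm)).
apply: eq_bigr => b _; rewrite mulr1n.
transitivity (\sum_(a <- box m) (f b *+ (mone == a)) *+ (mmul a b == m)).
  by apply: eq_bigr => a _; rewrite /= mulr_natl eq_sym.
rewrite (@big_delta _ (fun a => mmul a b == m) (fun=> f b)).
  by rewrite mul1m eq_sym.
by move=> /eqP <-.
Qed.

Let mul3 f g h m := \sum_(a <- box m) \sum_(b <- box m) \sum_(c <- box m)
  (f a * g b * h c) *+ (mmul a (mmul b c) == m).

Let mul_mul3 f g h m : fps_mul f (fps_mul g h) m = mul3 f g h m.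
Proof.
rewrite (@mulE (box m)); last by move=> a b <-.
apply: eq_bigr => a _.
transitivity (\sum_(e <- box m) \sum_(b <- box m) \sum_(c <- box m)
    (f a * g b * h c) *+ (mmul b c == e) *+ (mmul a e == m)).
  apply: eq_bigr => e _; case: eqP => [aem|_]; last first.
    by symmetry; rewrite mulr0n big1 // => b _; rewrite big1.
  rewrite mulr1n (@mulE (box m)); last first.
    by move=> b c bce; rewrite -aem -bce mulmC -mulmA.
  rewrite mulr_sumr; apply: eq_bigr => b _; rewrite mulr_sumr.
  by apply: eq_bigr => c _; rewrite mulr1n mulrnAr mulrA.
rewrite exchange_big; apply: eq_bigr => b _.
rewrite exchange_big; apply: eq_bigr => c _.
rewrite (@big_delta _ (fun e => mmul a e == m) (fun=> _)) //.
by move=> /eqP <-; rewrite (mulmC a).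
Qed.

Fact fps_mulA : associative fps_mul.
Proof.
move=> f g h; apply/fpsP => m.
rewrite mul_mul3 (fps_mulC (fps_mul f g)) mul_mul3 /mul3 [RHS]exchange_big.
apply: eq_bigr => a _; rewrite [RHS]exchange_big.
apply: eq_bigr => b _; apply: eq_bigr => c _.
by rewrite /= -[h c * f a * g b]mulrA [h c * _]mulrC (mulmC c) -mulmA.
Qed.

Fact fps_one_neq0 : fps_monom mone != 0.
Proof.
by apply/eqP => /(congr1 (fun f : fps X R => f mone))/eqP/=; rewrite eqxx oner_eq0.
Qed.

HB.instance Definition _ := GRing.Zmodule_isComNzRing.Build (fps X R)
  fps_mulA fps_mulC fps_mul1 fps_mulDl fps_one_neq0.

Fact fps_scaleAl (r : R) f g : r *: (f * g) = r *: f * g.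
Proof.
apply/fpsP => m; transitivity (r * fps_mul f g m); first by [].
transitivity (fps_mul (fps_scale r f) g m); last by [].
rewrite !(@mulE (box m)); try by move=> a b <-.
rewrite mulr_sumr; apply: eq_bigr => a _; rewrite mulr_sumr.
by apply: eq_bigr => b _; rewrite mulrnAr mulrA.
Qed.
HB.instance Definition _ :=
  GRing.Lmodule_isLalgebra.Build R (fps X R) fps_scaleAl.
HB.instance Definition _ := GRing.Lalgebra_isComAlgebra.Build R (fps X R).

(* Coefficientwise sum of a possibly infinite family, meant for families that
   are summable, i.e. such that each monomial occurs in finitely many F i. *)
Definition fps_sum (I : choiceType) (A : set I) (F : I -> fps X R) : fps X R :=
  FPS (fun m => \sum_(i \in A) F i m).

End PowerSeriesRing.

(* Meant for f with zero constant term, in characteristic 0. *)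
Definition fps_exp (X : choiceType) (K : fieldType) (f : fps X K) : fps X K :=
  fps_sum [set: nat]%classic (fun k => k`!%:R^-1 *: f ^+ k).

(* For positive n; p | n with logn p n = 1 for all p means squarefree. *)
Definition moebius (n : nat) : int :=
  if all (fun p => logn p n == 1%N) (primes n) then (-1) ^+ size (primes n)
  else 0.

Definition is_intpart (n : nat) (s : seq nat) : bool :=
  [&& sorted geq s, 0%N \notin s & sumn s == n].

(* A partition of n has at most n parts, each of which is at most n; the
   bounded type only serves to make intpart n a finite type. *)
Record intpart (n : nat) := IntPart {
  intpart_bseq : n.-bseq 'I_n.+1;
  _ : is_intpart n (map val intpart_bseq)
}.
HB.instance Definition _ n := [isSub for @intpart_bseq n].
HB.instance Definition _ n := [Finite of intpart n by <:].

Definition parts n (la : intpart n) : seq nat := map val (intpart_bseq la).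
Coercion parts : intpart >-> seq.

Definition cycle_type n (x : 'S_n) : seq nat :=
  sort geq [seq #|pred_of_set c| | c <- enum (porbits x)].

Section HigherLie.
Variables (zeta : nat -> algC).
Hypothesis zeta_prim : forall i, (0 < i)%N -> i.-primitive_root (zeta i).
Variables (n : nat) (x : 'S_n).
Implicit Types (z w : 'S_n) (p q : 'I_n).

(* Each point q lies in the cycle of x through the base point froot x q, at
   position lie_label q; the pair (froot x q, lie_label q) is the label (r, t)
   of q, and x increments t modulo the length of the cycle. *)
Definition lie_label q : nat := findex x (froot x q) q.

(* The base point p of a cycle has label (p, 0), so z p has label
   (sigma p, k_p). The product over all the base points gathers the factors
   omega_i(z_i) for all the cycle lengths i. *)
Definition lie_weight z : algC :=
  \prod_(p | froots x p) zeta (fingraph.order x p) ^+ lie_label (z p).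

Let xI : injective x := @perm_inj _ x.
Let xS := fconnect_sym xI.

Let zeta_order p : zeta (fingraph.order x p) ^+ fingraph.order x p = 1.
Proof. by apply/prim_expr_order/zeta_prim/fingraph.order_gt0. Qed.

Let iter_label q : iter (lie_label q) x (froot x q) = q.
Proof. by apply: iter_findex; rewrite xS connect_root. Qed.

Let cent_iter z k q : z \in 'C[x]%g -> z (iter k x q) = iter k x (z q).
Proof.
move=> /cent1P xz; elim: k => //= k <-.
by have /permP/(_ (iter k x q)) := xz; rewrite !permM.
Qed.

Let order_connect p q : fconnect x p q -> fingraph.order x p = fingraph.order x q.
Proof. by move=> pq; apply/eq_card/(same_connect xS pq). Qed.

Let cent_connect z p q :
  z \in 'C[x]%g -> fconnect x p q -> fconnect x (z p) (z q).
Proof.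
by move=> xz /iter_findex <-; rewrite cent_iter // fconnect_iter.
Qed.

Let cent_order z p : z \in 'C[x]%g -> fingraph.order x (z p) = fingraph.order x p.
Proof.
suff le_order w q : w \in 'C[x]%g -> (fingraph.order x q <= fingraph.order x (w q))%N.
  move=> xz; apply/eqP; rewrite eqn_leq le_order // andbT.
  by rewrite -{2}(permK z p) le_order // groupV.
move=> xw; rewrite /fingraph.order -(card_image (@perm_inj _ w)).
by apply/subset_leq_card/subsetP => _ /imageP[r qr ->]; apply: cent_connect.
Qed.

Let zeta_label k q :
  zeta (fingraph.order x q) ^+ lie_label (iter k x q) =
  zeta (fingraph.order x q) ^+ (k + lie_label q).
Proof.
pose b := froot x q.
have bq : fconnect x b q by rewrite xS connect_root.
have -> : fingraph.order x q = fingraph.order x b by rewrite -(order_connect bq).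
have rb : froot x (iter k x q) = b.
  by apply/eqP; rewrite (root_connect xS) xS fconnect_iter.
rewrite /lie_label rb -{1}(iter_label q) -iterD -/b.
set j := (k + _)%N.
have -> : iter j x b = iter (j %% fingraph.order x b) x b.
  rewrite {1}(divn_eq j (fingraph.order x b)) addnC iterD; congr iter.
  elim: (j %/ _)%N => // d IHd.
  by rewrite mulSn iterD IHd iter_order.
by rewrite findex_iter ?ltn_mod ?fingraph.order_gt0 // expr_mod.
Qed.

Let lie_weightM z w : z \in 'C[x]%g -> w \in 'C[x]%g ->
  lie_weight (z * w)%g = lie_weight z * lie_weight w.
Proof.
move=> xz xw; rewrite {3}/lie_weight.
pose h (u : 'S_n) p := froot x (u p).
have hK u v q : v \in 'C[x]%g -> (u * v = 1)%g -> h v (h u q) = froot x q.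
  move=> xv uv1; apply/eqP; rewrite (root_connect xS).
  rewrite -[q in fconnect _ _ q](perm1 q) -uv1 permM cent_connect //.
  by rewrite xS connect_root.
rewrite (reindex_onto (h z) (h z^-1%g)) => [|q /eqP {2}<-]; last first.
  by rewrite hK ?mulVg.
rewrite (eq_bigl (froots x)) => [|p]; last first.
  by rewrite hK ?groupV ?mulgV // (roots_root xS).
rewrite -big_split; apply: eq_bigr => p _ /=.
have zpE : fingraph.order x (h z p) = fingraph.order x p.
  by rewrite -(cent_order p xz); apply/esym/order_connect/connect_root.
rewrite zpE permM -exprD -{1}(iter_label (z p)) cent_iter // -/(h z p).
by rewrite -zpE -(cent_order _ xw) zeta_label.
Qed.

Let lie_weight_neq0 z : lie_weight z != 0.
Proof.
apply/prodf_neq0 => p _; rewrite expf_neq0 //.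
apply: contra_eq_neq (zeta_order p) => ->.
by rewrite expr0n gtn_eqF ?fingraph.order_gt0 // eq_sym oner_eq0.
Qed.

Fact lie_character_subproof :
  is_class_fun <<'C[x]>>%g [ffun z => lie_weight z *+ (z \in 'C[x]%g)].
Proof.
rewrite genGid; apply: intro_class_fun => [z w xz xw|z /negPf-> //].
rewrite groupJ // xz; apply: (mulfI (lie_weight_neq0 w)).
by rewrite !mulr1n -lie_weightM ?groupJ // -conjgC lie_weightM // mulrC.
Qed.

(* The linear character omega^x of the centralizer of x. *)
Definition lie_character : 'CF('C[x]) := Cfun 1 lie_character_subproof.

Definition higher_lie : 'CF([set: 'S_n]) := 'Ind[[set: 'S_n]] lie_character.

End HigherLie.

(* C[[s, t]], with algC for C since class functions are algC-valued: inl i stands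
   for s_i and inr j for t_j. The indeterminates s_0 and t_0 are not used. *)
Definition s_ (i : nat) : fps (nat + nat)%type algC := fps_var (inl i).
Definition t_ (j : nat) : fps (nat + nat)%type algC := fps_var (inr j).

Definition part_monom (v : nat -> fps (nat + nat)%type algC)
    n (la : intpart n) : fps (nat + nat)%type algC :=
  \prod_(1 <= i < n.+1) v i ^+ count_mem i la.

(* Main.v *)
(* Put H(x) = sum over z in C(x) of omega^x(z) t^c(z). Averaging the induced
   character over its class turns the degree n part of the left-hand side into
   1/n! times the sum of omega^x(z) s^c(x) t^c(z) over the commuting pairs
   (x, z) in S_n. A commuting pair is an action of Z^2, and this weight is
   multiplicative over its orbits. Peeling off the orbit of a point p gives the
   recurrence n a_n = sum_m c_m a_(n-m) satisfied by the exponential of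
   sum_m c_m / m, where m! c_m is the total weight of the transitive pairs on m
   points with a base point p. Such a pair is determined by the length i of the
   x-cycle of p, by k with z^(m/i) p = x^k p, and by the bijection
   (r, t) |-> x^t z^r p from 'I_(m/i) * 'I_i; it has weight
   zeta_i^k s_i^(m/i) t_(m/g)^g with g = gcd(i, k). Summing zeta_i^k over the k
   with gcd(i, k) = i/e gives mu(e), a Ramanujan sum. *)
Require Import Defs.
From HB Require Import structures.
From mathcomp Require Import boolp classical_sets functions cardinality fsbigop.
From mathcomp Require Import all_boot all_order all_algebra all_fingroup.
From mathcomp Require Import all_solvable all_field all_character.
From mathcomp Require Import finmap monalg.

Set Implicit Arguments.
Unset Strict Implicit.
Unset Printing Implicit Defensive.

Import GRing.Theory Num.Theory.
Local Open Scope ring_scope.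

(** * Ramanujan sums *)

(** All permutations stay in [{perm T}] for one fixed T, with support in a varying set A. Peeling
    off an orbit O then replaces A by [A :\: O] without any transport between symmetric groups; the
    price is locality, namely that roots, labels and orders depend only on the restriction to a
    stable set.

    The recurrence determines a_n because n is invertible, so no logarithm of a series is taken. The
    exponential satisfies it because D (exp f) = (D f) exp f, where D multiplies the part of degree
    n by n and s_i has degree i. A term s_i^(j/e) t_j^(i/e) has degree ij/e, which is exactly its
    denominator in the exponent, so D clears the denominators and leaves c_m. In c_m the index of t
    is m/g; with g = i/e this is j = (m/i)e. *)

Lemma moebius_primeM p d : prime p -> (0 < d)%N ->
  moebius (p * d) = if (p %| d)%N then 0 else - moebius d.
Proof.
move=> pp d0; have p0 := prime_gt0 pp; rewrite /moebius.
have lognE q : prime q -> logn q (p * d) = ((q == p) + logn q d)%N.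
  by move=> qp; rewrite lognM // logn_prime // eq_sym.
have [pd|pd] := boolP (p %| d)%N.
  case: ifP => // /allP sqf.
  have : p \in primes (p * d) by rewrite mem_primes pp muln_gt0 p0 d0 dvdn_mulr.
  move=> /sqf; rewrite lognE // eqxx eqSS => /eqP pd0.
  by have := logn_gt0 p d; rewrite pd0 mem_primes pp d0 pd.
have pr : perm_eq (primes (p * d)) (p :: primes d).
  apply: uniq_perm; rewrite ?primes_uniq //=.
    by rewrite primes_uniq andbT mem_primes (negPf pd) !andbF.
  by move=> q; rewrite primesM // primes_prime // !inE.
rewrite (perm_size pr) (perm_all _ pr) /=.
rewrite lognE // eqxx logn_coprime ?prime_coprime //=.
have -> : all (fun q => logn q (p * d) == 1%N) (primes d) =
          all (fun q => logn q d == 1%N) (primes d).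
  apply: eq_in_all => q; rewrite mem_primes => /and3P[qp _ qd].
  by rewrite lognE //; case: (q =P p) => // qpE; rewrite -qpE qd in pd.
by case: ifP; rewrite ?oppr0 // exprS mulN1r.
Qed.

(** For a prime p dividing n = p m, the divisors of n are the p d with d dividing m, and the d
    dividing m that p does not divide. The contributions of p d and d cancel, and that of p d
    vanishes when p divides d. *)
Lemma sum_moebius n : (0 < n)%N ->
  \sum_(d <- divisors n) moebius d = (n == 1%N)%:R.
Proof.
move=> n0; have [->|n1] := eqVneq n 1%N; first by rewrite big_seq1.
have pp : prime (pdiv n) by rewrite pdiv_prime // ltn_neqAle eq_sym n1.
have /dvdnP[m] := pdiv_dvd n; move: (pdiv n) pp => p pp; rewrite mulnC => nE.
have m0 : (0 < m)%N by move: n0; rewrite nE muln_gt0 => /andP[].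
have p0 := prime_gt0 pp.
rewrite (bigID (fun d => p %| d)%N) /= -!(big_filter (divisors n)).
have div_p : perm_eq [seq d <- divisors n | p %| d]%N
                           [seq (p * d)%N | d <- divisors m].
  apply: uniq_perm; rewrite ?filter_uniq ?divisors_uniq //.
    by rewrite map_inj_uniq ?divisors_uniq // => a b /eqP; rewrite eqn_pmul2l // => /eqP.
  move=> d; rewrite mem_filter -dvdn_divisors //.
  apply/andP/mapP => [[/dvdnP[e ->]]|[e]].
    rewrite nE mulnC dvdn_pmul2l // => em.
    by exists e; rewrite -?dvdn_divisors.
  by rewrite -dvdn_divisors // => em ->; rewrite dvdn_mulr // nE dvdn_pmul2l.
have div_p' : perm_eq [seq d <- divisors n | ~~ (p %| d)]%N
                           [seq d <- divisors m | ~~ (p %| d)]%N.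
  apply: uniq_perm; rewrite ?filter_uniq ?divisors_uniq // => d.
  rewrite !mem_filter -!dvdn_divisors // nE.
  case pd: (p %| d)%N => //=.
  by rewrite Gauss_dvdr // coprime_sym prime_coprime // pd.
rewrite (perm_big _ div_p) (perm_big _ div_p') big_map big_filter.
rewrite [X in _ + X]big_mkcond -big_split big_seq big1 // => d.
rewrite -dvdn_divisors // => /(dvdn_gt0 m0) d0; rewrite moebius_primeM //=.
by case: ifP; rewrite ?addr0 // addNr.
Qed.

Lemma perm_div_divisors n : (0 < n)%N ->
  perm_eq [seq (n %/ d)%N | d <- divisors n] (divisors n).
Proof.
move=> n0; apply: uniq_perm; rewrite ?divisors_uniq ?map_inj_in_uniq ?divisors_uniq //.
  move=> a b; rewrite -!dvdn_divisors // => an bn ab.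
  by rewrite -[a](mulKn _ n0) -divnA // ab divnA // mulKn.
move=> d; rewrite -dvdn_divisors //; apply/mapP/idP => [[e]|dn].
  by rewrite -dvdn_divisors // => en ->; apply: dvdn_div.
by exists (n %/ d)%N; rewrite -?dvdn_divisors ?dvdn_div // divnA // mulKn.
Qed.

Lemma sum_gcdn (V : nmodType) n (f : 'I_n -> V) : (0 < n)%N ->
  \sum_(k < n) f k = \sum_(d <- divisors n) \sum_(k < n | gcdn n k == d) f k.
Proof.
move=> n0; rewrite (exchange_big_dep xpredT) //=; apply: eq_bigr => k _.
rewrite big_mkcond (bigD1_seq (gcdn n k)) ?divisors_uniq ?eqxx //=.
  by rewrite big1 ?addr0 // => d; rewrite eq_sym => /negPf ->.
by rewrite -dvdn_divisors // dvdn_gcdl.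
Qed.

Section RamanujanSum.
Variable F : fieldType.
Implicit Type z : F.

Lemma sum_expr_prim_root n z : n.-primitive_root z ->
  \sum_(k < n) z ^+ k = (n == 1%N)%:R.
Proof.
move=> zn; have [n1|n1] := eqVneq n 1%N; first by rewrite n1 big_ord1.
have z1 : z - 1 != 0 by rewrite subr_eq0 -[z]expr1 -(prim_order_dvd zn) dvdn1.
by apply: (mulfI z1); rewrite -subrX1 mulr0 prim_expr_order // subrr.
Qed.

(** The indices k are the g k' with k' < n/g coprime to n/g. *)
Lemma sum_expr_gcdn n g z : (0 < n)%N -> (g %| n)%N ->
  \sum_(k < n | gcdn n k == g) z ^+ k =
  \sum_(k < n %/ g | gcdn (n %/ g) k == 1%N) (z ^+ g) ^+ k.
Proof.
move=> n0 gn; have g0 := dvdn_gt0 n0 gn.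
have hP (k : 'I_(n %/ g)) : (k * g < n)%N by rewrite -ltn_divRL.
pose h k := Ordinal (hP k).
have ng0 : (0 < n %/ g)%N by rewrite divn_gt0 // dvdn_leq.
(* The default value of [insubd] is never reached: k < n gives k/g < n/g. *)
rewrite (reindex_onto h (fun k : 'I_n => insubd (Ordinal ng0) (k %/ g)%N)) /=.
  apply: eq_big => [k|k _]; last by rewrite /= mulnC exprM.
  rewrite -{1}(divnK gn) -muln_gcdl -[X in _ == X]mul1n eqn_pmul2r //.
  apply/andb_idr => _; apply/eqP/val_inj; rewrite val_insubd /=.
  by rewrite mulnK // ltn_ord.
move=> k /eqP gk; apply/val_inj; rewrite /= val_insubd ltn_divLR // divnK // ltn_ord.
by rewrite divnK // -gk dvdn_gcdr.
Qed.

(** For g > 1 the sum is one for the smaller order n/g and the primitive root z^g, covered by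
    induction. The case g = 1 follows by subtraction, since summed over all g dividing n both sides
    give 1 if n = 1 and 0 otherwise. *)
Lemma ramanujan_sum n g z : n.-primitive_root z -> (g %| n)%N ->
  \sum_(k < n | gcdn n k == g) z ^+ k = (moebius (n %/ g))%:~R.
Proof.
elim/ltn_ind: n g z => n IH g z zn gn; have n0 := prim_order_gt0 zn.
have div_big h : (h %| n)%N -> h != 1%N ->
    \sum_(k < n | gcdn n k == h) z ^+ k = (moebius (n %/ h))%:~R.
  move=> hn h1; have h0 := dvdn_gt0 n0 hn.
  rewrite sum_expr_gcdn // IH ?divn1 ?dvd1n ?ltn_Pdiv //.
    by rewrite ltn_neqAle eq_sym h1.
  by have := dvdn_prim_root zn (dvdn_div hn); rewrite divnA // mulKn.
have [g1|] := eqVneq g 1%N; last exact: div_big.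
have sumE (G : nat -> F) : \sum_(d <- divisors n) G d =
    G 1%N + \sum_(d <- divisors n | d != 1%N) G d.
  by rewrite (bigD1_seq 1%N) ?divisors_uniq // -dvdn_divisors.
have := sum_expr_prim_root zn.
have := sumE (fun d => (moebius (n %/ d))%:~R).
rewrite -[in X in X -> _](big_map (fun d => n %/ d)%N xpredT (fun d => (moebius d)%:~R)).
rewrite (perm_big _ (perm_div_divisors n0)) /=.
rewrite -rmorph_sum sum_moebius // divn1 rmorph_nat => ->.
rewrite sum_gcdn // sumE g1 divn1.
set S := (X in _ + X = _ -> _); set S' := (X in _ = _ + X -> _).
suff -> : S = S' by move/addIr.
rewrite /S /S' big_seq_cond [RHS]big_seq_cond; apply: eq_bigr => d.
by rewrite -dvdn_divisors // => /andP[? ?]; apply: div_big.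
Qed.
End RamanujanSum.

(** * Exponentials of graded power series *)

Section PowerSeriesTheory.
Variables (X : choiceType) (K : numFieldType).
Implicit Types (f g : fps X K) (m a b : {cmonom X}).

Lemma fcoef_sum (I : Type) (r : seq I) (P : pred I) (F : I -> fps X K) m :
  (\sum_(i <- r | P i) F i) m = \sum_(i <- r | P i) F i m.
Proof. by elim/big_rec2: _ => // i _ f _ <-. Qed.

Lemma fcoefD f g m : (f + g) m = f m + g m.
Proof. by []. Qed.

Lemma fcoefZ c f m : (c *: f) m = c * f m.
Proof. by []. Qed.

(** A factor of m is supported in the support of m, with exponents at most the degree of m. *)
Lemma finite_factorizations m :
  finite_set [set p : {cmonom X} * {cmonom X} | mmul p.1 p.2 = m]%classic.
Proof.
pose F (u : {ffun finsupp m -> 'I_(mdeg m).+1}) : {cmonom X} :=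
  [cmonom (u i : nat) | i : finsupp m]%M.
have FP a b : mmul a b = m -> exists u, F u = a.
  move=> abm; have le_am i : (a i <= mdeg m)%N.
    rewrite -abm mdegM (leq_trans _ (leq_addr _ _)) // mdegE.
    have [ai|] := mdomP a i; last by [].
    by rewrite (big_fsetD1 i) //= leq_addr.
  exists [ffun i => inord (a (val i))]; apply/eqP/cmP => i.
  rewrite cmE fsfun_ffun; case: insubP => /= [u _ <-|im].
    by rewrite ffunE inordK // ltnS.
  by apply/esym/eqP; move: im; rewrite -cmE_eq0 -abm cmM addn_eq0 => /andP[].
have /sub_finite_set : ([set p | mmul p.1 p.2 = m] `<=`
    [set (F u.1, F u.2) | u in [set: _]])%classic.
  move=> [a b] /= abm; have [u uE] := FP _ _ abm.
  have [v vE] : exists u, F u = b by apply: (FP b a); rewrite mulmC.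
  by exists (u, v); rewrite //= uE vE.
by apply; apply: finite_image; apply: finite_finset.
Qed.

Definition factorizations m : seq ({cmonom X} * {cmonom X}) :=
  fset_set [set p : {cmonom X} * {cmonom X} | mmul p.1 p.2 = m]%classic.

Lemma mem_factorizations m p : p \in factorizations m -> mmul p.1 p.2 = m.
Proof.
by rewrite in_fset_set; [move/set_mem | exact: finite_factorizations].
Qed.

Lemma fcoefM f g m : (f * g) m = \sum_(p <- factorizations m) f p.1 * g p.2.
Proof. exact/fsbig_finite/finite_factorizations. Qed.

Lemma fps_sum1E (I : choiceType) (F : I -> fps X K) m i :
  (forall j, j != i -> F j m = 0) -> fps_sum [set: I]%classic F m = F i m.
Proof.
move=> F0; rewrite /= (fsbigTE [fset i]%fset) ?big_seq_fset1 // => j.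
by rewrite !inE => /F0.
Qed.

Variable wt : {cmonom X} -> nat.
Hypothesis wt1 : wt mone = 0%N.
Hypothesis wtM : forall a b, wt (mmul a b) = (wt a + wt b)%N.

(** The Euler derivation of the grading [wt], the analogue of x d/dx: it turns the exponential into
    a differential equation that can be read degree by degree. *)
Definition fps_euler f : fps X K := FPS (fun m => (wt m)%:R * f m).

Lemma fps_eulerE f m : fps_euler f m = (wt m)%:R * f m.
Proof. by []. Qed.

Definition fps_hom n f : fps X K := FPS (fun m => f m *+ (wt m == n)).

Lemma fps_homE n f m : fps_hom n f m = f m *+ (wt m == n).
Proof. by []. Qed.

Lemma fps_eulerM f g : fps_euler (f * g) = fps_euler f * g + f * fps_euler g.
Proof.
apply/fpsP => m; rewrite fcoefD fps_eulerE !fcoefM mulr_sumr -big_split.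
rewrite big_seq [RHS]big_seq; apply: eq_bigr => p /mem_factorizations <-.
by rewrite !fps_eulerE wtM natrD mulrDl !mulrA [f _ * _ in RHS]mulrC.
Qed.

Lemma fps_euler1 : fps_euler 1 = 0.
Proof.
apply/fpsP => m; rewrite fps_eulerE -[fcoef 1 m]/((m == mone)%:R) -[RHS]/(0 : K).
by have [->|] := eqVneq m mone; rewrite ?wt1 ?mul0r ?mulr0.
Qed.

Lemma fps_eulerX f k : fps_euler (f ^+ k.+1) = k.+1%:R *: (fps_euler f * f ^+ k).
Proof.
elim: k => [|k IHk]; first by rewrite expr1 expr0 mulr1 scale1r.
rewrite exprS fps_eulerM IHk -scalerAr mulrCA -exprS -[X in X + _]scale1r.
by rewrite -scalerDl nat1r.
Qed.

Section Exp.
Variable f : fps X K.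
Hypothesis f0 : forall m, wt m = 0%N -> f m = 0.

Lemma fcoefX_eq0 k m : (wt m < k)%N -> (f ^+ k) m = 0.
Proof.
elim: k m => // k IHk m; rewrite ltnS => mk.
rewrite exprS fcoefM big_seq big1 // => p /mem_factorizations pm.
have [/f0->|p1] := eqVneq (wt p.1) 0%N; first by rewrite mul0r.
rewrite IHk ?mulr0 // (leq_trans _ mk) // -pm wtM -addn1 addnC leq_add2r.
by rewrite lt0n.
Qed.

(** The power f^k starts in degree k, so the exponential is a finite sum in each degree. The bound N
    is left free so that one truncation serves all the factors of a monomial at once. *)
Lemma fcoef_exp N m : (wt m <= N)%N ->
  fps_exp f m = \sum_(k < N.+1) k`!%:R^-1 * (f ^+ k) m.
Proof.
move=> mN; rewrite /fps_exp /= (fsbigE (iota 0 N.+1)) ?iota_uniq //.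
  under eq_bigl do rewrite classical_sets.in_setT.
  by rewrite -(big_mkord xpredT (fun k => k`!%:R^-1 * (f ^+ k) m)) /index_iota subn0.
move=> k _; rewrite mem_iota /= add0n -leqNgt => Nk.
by rewrite fcoefX_eq0 ?mulr0 // (leq_ltn_trans mN).
Qed.

Lemma fps_euler_exp : fps_euler (fps_exp f) = fps_euler f * fps_exp f.
Proof.
apply/fpsP => m; rewrite fcoefM fps_eulerE.
(* One term more than necessary: the derivation kills the term k = 0 and sends the term k+1 to
   [fps_euler f] times the term k, so what remains has the range k <= wt m used on the right. *)
rewrite (@fcoef_exp (wt m).+1) // big_ord_recl mulrDr.
have -> : (wt m)%:R * (0`!%:R^-1 * (f ^+ 0) m) = 0.
  by rewrite mulrCA -fps_eulerE fps_euler1 mulr0.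
transitivity (\sum_(p <- factorizations m) \sum_(k < (wt m).+1)
    k`!%:R^-1 * (fps_euler f p.1 * (f ^+ k) p.2)).
  rewrite add0r exchange_big mulr_sumr; apply: eq_bigr => k _.
  rewrite -mulr_sumr -fcoefM mulrCA -fps_eulerE fps_eulerX fcoefZ mulrA.
  congr (_ * _); rewrite factS natrM invfM mulrAC mulVf ?mul1r //.
  by rewrite pnatr_eq0.
rewrite big_seq [RHS]big_seq; apply: eq_bigr => p /mem_factorizations pm.
rewrite (@fcoef_exp (wt m)); last by rewrite -pm wtM leq_addl.
by rewrite mulr_sumr; apply: eq_bigr => k _; rewrite mulrCA.
Qed.

End Exp.

Lemma fps_homM n f g :
  fps_hom n (f * g) = \sum_(m < n.+1) fps_hom m f * fps_hom (n - m)%N g.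
Proof.
apply/fpsP => m; rewrite fcoef_sum fps_homE fcoefM.
under [RHS]eq_bigr do rewrite fcoefM.
rewrite exchange_big /= -sumrMnl big_seq [RHS]big_seq.
apply: eq_bigr => p /mem_factorizations pm.
have [mn|mn] := eqVneq (wt m) n.
  have p1 : (wt p.1 < n.+1)%N by rewrite ltnS -mn -pm wtM leq_addr.
  rewrite (bigD1 (Ordinal p1)) //= big1 => [|k]; last first.
    by rewrite -val_eqE /= eq_sym => /negPf ->; rewrite mul0r.
  have p2 : (n - wt p.1 = wt p.2)%N by rewrite -mn -pm wtM addKn.
  by rewrite p2 !eqxx addr0 !mulr1n.
rewrite big1 // => k _; case: eqP => [p1|]; rewrite ?mul0r //.
case: eqP => [p2|]; rewrite ?mulr0 //; case/eqP: mn.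
by rewrite -pm wtM p1 p2 subnKC // -ltnS.
Qed.

Lemma fps_hom_euler n f : fps_hom n (fps_euler f) = n%:R *: fps_hom n f.
Proof.
apply/fpsP => m; rewrite fps_homE fcoefZ fps_eulerE fps_homE mulrnAr.
by case: eqP => [->|].
Qed.

Lemma fps_sum_hom f : fps_sum [set: nat]%classic (fun n => fps_hom n f) = f.
Proof.
apply/fpsP => m; rewrite (@fps_sum1E _ _ _ (wt m)) ?fps_homE ?eqxx // => n.
by rewrite fps_homE eq_sym => /negPf ->.
Qed.

Lemma fps_hom_exp n f : (forall m, wt m = 0%N -> f m = 0) ->
  n%:R *: fps_hom n (fps_exp f) =
  \sum_(m < n.+1) fps_hom m (fps_euler f) * fps_hom (n - m)%N (fps_exp f).
Proof. by move=> f0; rewrite -fps_hom_euler fps_euler_exp // fps_homM. Qed.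

Lemma fps_hom0_exp f : (forall m, wt m = 0%N -> f m = 0) ->
  fps_hom 0 (fps_exp f) = 1.
Proof.
move=> f0; apply/fpsP => m; rewrite fps_homE.
have [m0|m0] := eqVneq (wt m) 0%N.
  by rewrite (@fcoef_exp f f0 0) ?m0 // big_ord1 invr1 mul1r.
have [m1|] := eqVneq m mone; first by rewrite m1 wt1 in m0.
by rewrite -[RHS]/((m == mone)%:R) => /negPf ->.
Qed.

End PowerSeriesTheory.

(** * Local weights *)

Section Iteration.
Local Open Scope nat_scope.
Variable T : finType.
Implicit Types (f g : T -> T) (q : T).

Lemma iter_comm f g m n q : (forall q, f (g q) = g (f q)) ->
  iter m f (iter n g q) = iter n g (iter m f q).
Proof.
move=> fg; have fgn k r : f (iter k g r) = iter k g (f r).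
  by elim: k => //= k <-.
by elim: m => //= m ->.
Qed.

Lemma order_dvdn f q n : injective f ->
  (fingraph.order f q %| n) = (iter n f q == q).
Proof.
move=> f_inj; have iterM k : iter (k * fingraph.order f q) f q = q.
  by elim: k => // k IHk; rewrite mulSn iterD IHk iter_order.
rewrite {2}(divn_eq n (fingraph.order f q)) addnC iterD iterM.
apply/idP/eqP => [/eqP-> //|nq]; apply/eqP.
have n_lt : (n %% fingraph.order f q < fingraph.order f q)%N.
  by rewrite ltn_mod fingraph.order_gt0.
by rewrite -(findex_iter n_lt) nq findex0.
Qed.

Lemma iter_modn_order f q n : injective f ->
  iter (n %% fingraph.order f q) f q = iter n f q.
Proof.
move=> f_inj; rewrite {2}(divn_eq n (fingraph.order f q)) addnC iterD.
congr iter; apply/esym/eqP; rewrite -order_dvdn //; exact: dvdn_mull.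
Qed.

Lemma order_comm f g q : injective f -> injective g ->
  (forall q, f (g q) = g (f q)) -> fingraph.order f (g q) = fingraph.order f q.
Proof.
move=> f_inj g_inj fg; apply/eqP; rewrite eqn_dvd !order_dvdn //.
have iter_fg n : iter n f (g q) = g (iter n f q).
  exact: (@iter_comm f g n 1).
rewrite iter_fg iter_order // eqxx /=.
by apply/eqP/g_inj; rewrite -iter_fg iter_order.
Qed.

Lemma iter_id_inj f n : (forall q, iter n.+1 f q = q) -> injective f.
Proof. by move=> fK q r fqr; rewrite -[q]fK -[r]fK !iterSr fqr. Qed.

Lemma fconnect_iterP f q r : reflect (exists n, r = iter n f q) (fconnect f q r).
Proof.
by apply: (iffP idP) => [/iter_findex <-|[n ->]]; [exists (findex f q r) | apply: fconnect_iter].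
Qed.

Section Local.
Variables (O : {set T}) (f g : T -> T).
Hypothesis fO : forall q, q \in O -> f q \in O.
Hypothesis fgO : forall q, q \in O -> f q = g q.

Lemma iter_stable n q : q \in O -> iter n f q \in O.
Proof. by move=> qO; elim: n => //= n; apply: fO. Qed.

Lemma eq_in_iter n q : q \in O -> iter n f q = iter n g q.
Proof. by move=> qO; elim: n => //= n <-; rewrite fgO ?iter_stable. Qed.

Lemma eq_in_fconnect q : q \in O -> fconnect f q =1 fconnect g q.
Proof.
move=> qO r; apply/fconnect_iterP/fconnect_iterP => -[n ->]; exists n.
  exact: eq_in_iter.
by rewrite eq_in_iter.
Qed.

(** A root is picked by a choice that depends only on the connectedness predicate, so a change of f
    outside O does not move the roots in O. *)
Lemma eq_in_froot q : q \in O -> froot f q = froot g q.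
Proof. by move=> qO; rewrite /fingraph.root (eq_pick (eq_in_fconnect qO)). Qed.

Lemma froot_stable q : q \in O -> froot f q \in O.
Proof.
move=> qO; have /fconnect_iterP[n ->] := connect_root (frel f) q.
exact: iter_stable.
Qed.

Lemma eq_in_order q : q \in O -> fingraph.order f q = fingraph.order g q.
Proof. by move=> qO; apply: eq_card (eq_in_fconnect qO). Qed.

Lemma eq_in_findex q r : q \in O -> findex f q r = findex g q r.
Proof.
move=> qO; rewrite /findex /fingraph.orbit -(eq_in_order qO); congr index.
apply: (@eq_from_nth _ q); rewrite !size_traject // => n nq.
by rewrite !nth_traject // eq_in_iter.
Qed.

End Local.

End Iteration.

Section LocalWeight.
Variables (zeta : nat -> algC) (R : comAlgType algC) (s t : nat -> R).
Variable T : finType.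
Implicit Types (x z : {perm T}) (O : {set T}) (p q : T).

Definition cycle_label x q : nat := findex x (froot x q) q.

(* Carrying the factors of a cycle at its root makes the weight of (x, z) a
   product over the points, in which the factor at q only depends on the
   restrictions of x and z to the orbit of q. *)
Definition point_weight x z q : R :=
  (if froots x q then
     zeta (fingraph.order x q) ^+ cycle_label x (z q) *: s (fingraph.order x q)
   else 1) *
  (if froots z q then t (fingraph.order z q) else 1).

Lemma eq_in_point_weight O x z x1 z1 q :
  (forall q, q \in O -> x q \in O) -> (forall q, q \in O -> x q = x1 q) ->
  (forall q, q \in O -> z q \in O) -> (forall q, q \in O -> z q = z1 q) ->
  q \in O -> point_weight x z q = point_weight x1 z1 q.
Proof.
move=> xO xx1 zO zz1 qO; rewrite /point_weight /cycle_label /roots.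
have zqO := zO _ qO; rewrite -zz1 //.
rewrite -(@eq_in_order T O x x1) //.  rewrite -(@eq_in_order T O z z1) //=.
rewrite -!(@eq_in_froot T O x x1) // -!(@eq_in_froot T O z z1) //=.
by rewrite (@eq_in_findex T O x x1) // froot_stable.
Qed.

Hypothesis zeta_prim : forall i, (0 < i)%N -> i.-primitive_root (zeta i).

(** A potential for the weights: each step of x multiplies it by zeta_i on cycles of length i, and
    it is 1 at the roots. The factor of omega^x at a root q is thus the quotient of its values at z
    q and q, which is what makes products telescope. *)
Definition cycle_char x q : algC :=
  zeta (fingraph.order x q) ^+ cycle_label x q.

Lemma cycle_char_neq0 x q : cycle_char x q != 0.
Proof.
rewrite expf_neq0 //; apply: contraTneq (fingraph.order_gt0 x q) => z0.
have := zeta_prim (fingraph.order_gt0 x q) => /prim_expr_order; rewrite z0 => /eqP.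
by rewrite expr0n; case: fingraph.order => //= n; rewrite eq_sym oner_eq0.
Qed.

Lemma iter_cycle_label x q : iter (cycle_label x q) x (froot x q) = q.
Proof. by apply: iter_findex; rewrite fconnect_sym ?connect_root //; apply: perm_inj. Qed.

Lemma order_iter x n q : fingraph.order x (iter n x q) = fingraph.order x q.
Proof.
elim: n => //= n <-; apply: order_comm => //; exact: perm_inj.
Qed.

Lemma order_froot x q : fingraph.order x (froot x q) = fingraph.order x q.
Proof. by rewrite -(order_iter x (cycle_label x q)) iter_cycle_label. Qed.

Lemma froot_iter x n q : froot x (iter n x q) = froot x q.
Proof.
apply/eqP; rewrite root_connect ?fconnect_iter //; last exact/fconnect_sym/perm_inj.
by rewrite fconnect_sym ?fconnect_iter //; exact: perm_inj.
Qed.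

Lemma cycle_label_iter x n q :
  cycle_label x (iter n x q) = ((n + cycle_label x q) %% fingraph.order x q)%N.
Proof.
rewrite {1}/cycle_label froot_iter.
have -> : iter n x q = iter (n + cycle_label x q) x (froot x q).
  by rewrite iterD iter_cycle_label.
rewrite -iter_modn_order; last exact: perm_inj.
by rewrite findex_iter ?ltn_mod ?fingraph.order_gt0 // order_froot.
Qed.

Lemma cycle_char_iter x n q :
  cycle_char x (iter n x q) = zeta (fingraph.order x q) ^+ n * cycle_char x q.
Proof.
rewrite /cycle_char order_iter -exprD cycle_label_iter prim_expr_mod //.
exact/zeta_prim/fingraph.order_gt0.
Qed.

Lemma cycle_char_root x q : froots x q -> cycle_char x q = 1.
Proof. by move=> /eqP qr; rewrite /cycle_char /cycle_label qr findex0. Qed.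

End LocalWeight.

(** * Transitive commuting pairs *)

Section Frame.
Variable T : finType.
Implicit Types (x z : {perm T}) (O : {set T}) (p q : T).

(** For commuting x and z this is the orbit of p under the group they generate, since every word in
    x and z can be sorted into x^t z^r. *)
Definition orbit2 x z p : {set T} := \bigcup_(q in porbit z p) porbit x q.

Lemma orbit2P x z p q :
  reflect (exists r t, q = iter t x (iter r z p)) (q \in orbit2 x z p).
Proof.
apply: (iffP bigcupP) => [[_ /porbitP[r ->] /porbitP[t ->]]|[r [t ->]]].
  by exists r, t; rewrite !permX.
by exists (iter r z p); rewrite -!permX mem_porbit.
Qed.

(* Each q in the orbit O is x^t z^r p for a unique (r, t) in [0, a) * [0, i);
   the relation z^a p = x^k p tells how this grid closes up. *)
Record frame x z p (a i k : nat) O : Prop := Frame {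
  frame_order : fingraph.order x p = i;
  frame_return : iter a z p = iter k x p;
  frame_gt0 : (0 < a)%N;
  frame_lt : (k < i)%N;
  frame_inj : forall r t r' t', (r < a)%N -> (t < i)%N -> (r' < a)%N ->
    (t' < i)%N -> iter t x (iter r z p) = iter t' x (iter r' z p) ->
    r = r' /\ t = t';
  frame_mem : forall q, q \in O <->
    exists r t, [/\ (r < a)%N, (t < i)%N & q = iter t x (iter r z p)]
}.

Section Commuting.
Variables (x z : {perm T}) (p : T).
Hypothesis xz : forall q, x (z q) = z (x q).

Lemma perm_iter_comm m n q : iter m x (iter n z q) = iter n z (iter m x q).
Proof. exact: iter_comm. Qed.

Lemma order_iter_comm n q : fingraph.order x (iter n z q) = fingraph.order x q.
Proof.
by elim: n => //= n <-; apply: order_comm => //; apply: perm_inj.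
Qed.

(** Every a steps of z from p can be traded for k steps of x: by commutation z^(na) p = x^(nk) p. *)
Lemma iter_reduce a k r t : iter a z p = iter k x p ->
  iter t x (iter r z p) =
  iter ((t + r %/ a * k) %% fingraph.order x p) x (iter (r %% a) z p).
Proof.
move=> ret; have retn n : iter (n * a) z p = iter (n * k) x p.
  elim: n => // n IH; rewrite !mulSn !iterD IH.
  by rewrite -perm_iter_comm ret -!iterD addnC.
rewrite -(order_iter_comm (r %% a) p) iter_modn_order; last exact: perm_inj.
by rewrite {1}(divn_eq r a) addnC iterD retn -perm_iter_comm -iterD.
Qed.

(** Take for a the least positive number of steps after which z brings p back to its own x-cycle. A
    coincidence between rows r < r' < a would bring p back after r' - r steps, against minimality;
    within a row, t < i is determined. *)
Lemma frame_exists : exists a, frame x z p a (fingraph.order x p)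
  (findex x p (iter a z p)) (orbit2 x z p).
Proof.
set i := fingraph.order x p; have x_inj := @perm_inj T x; have z_inj := @perm_inj T z.
have ex_return : exists a, (0 < a)%N && fconnect x p (iter a z p).
  by exists (fingraph.order z p); rewrite fingraph.order_gt0 iter_order ?connect0.
case: (ex_minnP ex_return) => a /andP[a0 pa] a_min; exists a.
have itern_inj (y : {perm T}) n : injective (iter n y).
  by elim: n => //= n IH q r /perm_inj/IH.
have ret : iter a z p = iter (findex x p (iter a z p)) x p by rewrite iter_findex.
have k_lt := findex_max pa; move: (findex _ _ _) ret k_lt => k ret k_lt.
have inj_le r t r' t' : (r < a)%N -> (t < i)%N -> (r' < a)%N -> (t' < i)%N ->
    (r <= r')%N -> iter t x (iter r z p) = iter t' x (iter r' z p) ->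
    r = r' /\ t = t'.
  move=> ra ti r'a t'i rr' eq_pt.
  have r_eq : r = r'.
    apply/eqP; rewrite eqn_leq rr' /= -subn_eq0; apply: contraTT r'a.
    rewrite -lt0n -leqNgt => d0; apply: leq_trans (leq_subr r r').
    apply: a_min; rewrite d0.
    have : iter t x p = iter t' x (iter (r' - r) z p).
      apply: (itern_inj z r); rewrite -!perm_iter_comm eq_pt.
      by rewrite -iterD subnKC.
    move=> eq_t; apply: connect_trans (fconnect_iter x t p) _.
    by rewrite eq_t fconnect_sym // fconnect_iter.
  split=> //; move: eq_pt; rewrite -r_eq !perm_iter_comm => /itern_inj eq_t.
  by rewrite -(findex_iter ti) eq_t findex_iter.
split=> //.
  move=> r t r' t' ra ti r'a t'i eq_pt; have [rr'|/ltnW rr'] := leqP r r'.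
    exact: inj_le.
  by have [] := inj_le r' t' r t r'a t'i ra ti rr' (esym eq_pt).
move=> q; split=> [/orbit2P|] [r [t]]; last first.
  by move=> [_ _ ->]; apply/orbit2P; exists r, t.
move=> ->; exists (r %% a)%N, ((t + r %/ a * k) %% i)%N.
by rewrite !ltn_mod a0 fingraph.order_gt0 -iter_reduce.
Qed.

Section InFrame.
Variables (a i k : nat) (O : {set T}).
Hypothesis F : frame x z p a i k O.

Lemma frame_card : #|O| = (a * i)%N.
Proof.
have -> : O = [set iter (rt.2 : 'I_i) x (iter (rt.1 : 'I_a) z p) | rt in setT].
  apply/setP=> q; apply/idP/imsetP => [/(frame_mem F)[r [t [ra ti ->]]]|[[r t] _ ->]].
    by exists (Ordinal ra, Ordinal ti).
  by apply/(frame_mem F); exists r, t.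
rewrite card_imset ?cardsT ?card_prod ?card_ord // => -[r t] [r' t'] /=.
move=> /(frame_inj F (ltn_ord r) (ltn_ord t) (ltn_ord r') (ltn_ord t')).
by case=> /val_inj -> /val_inj ->.
Qed.

Lemma frame_dvdn : (#|O| %/ i = a)%N.
Proof.
rewrite frame_card mulnK //; exact: leq_ltn_trans (frame_lt F).
Qed.

Lemma frame_orbit : O = orbit2 x z p.
Proof.
apply/setP=> q; apply/(sameP idP)/(iffP (orbit2P x z p q)) => [[r [t ->]]|]; last first.
  by move=> /(frame_mem F)[r [t [_ _ ->]]]; exists r, t.
rewrite (iter_reduce _ _ (frame_return F)); apply/(frame_mem F).
exists (r %% a)%N, ((t + r %/ a * k) %% i)%N.
by rewrite (frame_order F) !ltn_mod (frame_gt0 F) (leq_ltn_trans _ (frame_lt F)).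
Qed.

Lemma frame_iter r t : iter t x (iter r z p) \in O.
Proof. by rewrite frame_orbit; apply/orbit2P; exists r, t. Qed.

Lemma frame_stable : (forall q, q \in O -> x q \in O) /\
  (forall q, q \in O -> z q \in O).
Proof.
split=> q /(frame_mem F)[r [t [_ _ ->]]]; first exact: (frame_iter r t.+1).
have -> : z (iter t x (iter r z p)) = iter t x (iter r.+1 z p).
  exact/esym/(perm_iter_comm t 1).
exact: frame_iter.
Qed.

Lemma frame_order_l q : q \in O -> fingraph.order x q = i.
Proof.
move=> /(frame_mem F)[r [t [_ _ ->]]].
by rewrite order_iter order_iter_comm (frame_order F).
Qed.

(** Since x and z commute, all points of O have the same z-order as p. In the grid, z^n p = p means
    that a divides n and i divides (n/a) k, that is, i/gcd(i,k) divides n/a. *)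
Lemma frame_order_r q : q \in O ->
  fingraph.order z q = (a * (i %/ gcdn i k))%N.
Proof.
have i0 : (0 < i)%N by exact: leq_ltn_trans (frame_lt F).
have g0 : (0 < gcdn i k)%N by rewrite gcdn_gt0 i0.
move=> /(frame_mem F)[r [t [_ _ ->]]].
have -> : fingraph.order z (iter t x (iter r z p)) = fingraph.order z p.
  rewrite perm_iter_comm order_iter; elim: t => //= t <-.
  by apply: order_comm => //; apply: perm_inj.
suff dvdE n : (fingraph.order z p %| n)%N = (a * (i %/ gcdn i k) %| n)%N.
  by apply/eqP; rewrite eqn_dvd dvdE dvdnn -dvdE dvdnn.
rewrite order_dvdn; last exact: perm_inj.
have := iter_reduce n 0 (frame_return F); rewrite add0n /= (frame_order F) => ->.
have -> : (a * (i %/ gcdn i k) %| n)%N = (a %| n)%N && (i %| n %/ a * k)%N.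
  case an: (a %| n)%N; last first.
    by apply: contraFF an => /(dvdn_trans (dvdn_mulr _ (dvdnn a))).
  rewrite -{1}(divnK an) mulnC dvdn_pmul2r ?(frame_gt0 F) //.
  have -> : (i %| n %/ a * k)%N =
      (i %/ gcdn i k * gcdn i k %| n %/ a * (k %/ gcdn i k) * gcdn i k)%N.
    by rewrite -mulnA !divnK ?dvdn_gcdl ?dvdn_gcdr.
  rewrite dvdn_pmul2r // Gauss_dvdl // /coprime -(eqn_pmul2r g0) mul1n muln_gcdl.
  by rewrite !divnK ?dvdn_gcdl ?dvdn_gcdr.
apply/eqP/andP => [|[/eqP-> /eqP->]//].
move=> /(frame_inj F (ltn_pmod _ (frame_gt0 F)) (ltn_pmod _ i0)
  (frame_gt0 F) i0 (t' := 0) (r' := 0)).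
by case=> /eqP ? /eqP.
Qed.

(** The x-cycles in O are the rows of the grid, one through each z^r p with r < a. *)
Lemma frame_roots :
  [set q in O | froots x q] = [set froot x (iter r z p) | r : 'I_a].
Proof.
apply/setP=> q; rewrite inE; apply/andP/imsetP => [[/(frame_mem F)]|[r _ ->]].
  move=> [r [t [ra _ ->]]] /eqP; rewrite froot_iter => <-.
  by exists (Ordinal ra).
split; last by rewrite /roots /= root_root //; apply/fconnect_sym/perm_inj.
apply: froot_stable; first by case: frame_stable.
exact: (frame_iter r 0).
Qed.

Lemma frame_root_inj : injective (fun r : 'I_a => froot x (iter r z p)).
Proof.
move=> r r' /eqP; rewrite root_connect; last exact/fconnect_sym/perm_inj.
move=> rr'; have := findex_max rr'; rewrite order_iter_comm (frame_order F) => lti.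
have := iter_findex rr' => /(frame_inj F (ltn_ord r) lti (ltn_ord r') (t' := 0)).
by case=> [|/val_inj]; first exact: leq_ltn_trans (frame_lt F).
Qed.

Section Weight.
Variables (zeta : nat -> algC) (R : comAlgType algC) (s t : nat -> R).
Hypothesis zeta_prim : forall i, (0 < i)%N -> i.-primitive_root (zeta i).

(** O splits into a cycles of x of length i, and into gcd(i,k) cycles of z of length #|O|/gcd(i,k).
    The powers of zeta_i telescope along p, z p, ..., z^a p = x^k p and leave zeta_i^k. *)
Lemma frame_weight :
  \prod_(q in O) point_weight zeta s t x z q =
  zeta i ^+ k *: (s i ^+ a * t (#|O| %/ gcdn i k) ^+ gcdn i k).
Proof.
have i0 : (0 < i)%N by exact: leq_ltn_trans (frame_lt F).
rewrite big_split -!big_mkcondr scalerAl; congr (_ * _).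
  transitivity (\prod_(q in [set q in O | froots x q])
      (cycle_char zeta x (z q) *: s i)).
    apply: eq_big => [q|q /andP[qO _]]; first by rewrite inE.
    rewrite /cycle_char !frame_order_l //; by have [_ ->] := frame_stable.
  rewrite frame_roots big_imset /=; last by move=> r r' _ _ /frame_root_inj.
  rewrite scaler_prod prodr_const card_ord; congr (_ *: _).
  (* If b is the root of the x-cycle of q = z^r p, then the label of z b is
     that of z q minus that of q. *)
  have telescope n : \prod_(r < n) cycle_char zeta x (z (froot x (iter r z p))) *
      cycle_char zeta x p = cycle_char zeta x (iter n z p).
    elim: n => [|n IHn]; first by rewrite big_ord0 mul1r.
    rewrite big_ord_recr /= mulrAC IHn; set q := iter n z p.
    have -> : z q = iter (cycle_label x q) x (z (froot x q)).
      by rewrite (@perm_iter_comm _ 1) /= iter_cycle_label.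
    rewrite cycle_char_iter //; congr (zeta _ ^+ _ * _).
    by rewrite (order_iter_comm 1) order_froot.
  apply: (mulIf (cycle_char_neq0 zeta_prim x p)).
  by rewrite telescope (frame_return F) cycle_char_iter // (frame_order F).
have g0 : (0 < gcdn i k)%N by rewrite gcdn_gt0 i0.
have oE : (a * (i %/ gcdn i k) = #|O| %/ gcdn i k)%N.
  by rewrite frame_card muln_divA ?dvdn_gcdl.
transitivity (\prod_(q in O | froots z q) t (#|O| %/ gcdn i k)%N).
  by apply: eq_bigr => q /andP[qO _]; rewrite frame_order_r ?oE.
rewrite prodr_const; congr (_ ^+ _); apply/eqP.
have o0 : (0 < a * (i %/ gcdn i k))%N.
  by rewrite muln_gt0 (frame_gt0 F) divn_gt0 // dvdn_leq ?dvdn_gcdl.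
(* The cycles of z are counted by their common length: number times length is #|O|. *)
rewrite -(eqn_pmul2r o0) [X in _ == X]mulnC -mulnA divnK ?dvdn_gcdl // -frame_card.
apply/eqP; rewrite -(@fcard_order_set _ z (@perm_inj _ z) (a * (i %/ gcdn i k))%N [in O]).
- congr (_ * _)%N; apply: eq_card => q; rewrite !inE andbC //.
- by apply/subsetP => q qO; rewrite inE frame_order_r.
- apply: intro_closed; first exact/fconnect_sym/perm_inj.
  by move=> q _ /eqP <- qO; case: frame_stable => _; apply.
Qed.
End Weight.
End InFrame.
End Commuting.
End Frame.

(** * Realizing every grid by a commuting pair, and counting *)

(** A step on indices descends to O when it is compatible with G. It is injective there because some
    positive iterate is the identity, and it is extended by the identity outside O. *)
Lemma step_perm (T : finType) (I : Type) (G : I -> T) (step : I -> I)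
    (O : {set T}) (n : nat) :
  (forall q, q \in O <-> exists i, q = G i) ->
  (forall i j, G i = G j -> G (step i) = G (step j)) ->
  (forall i, G (iter n.+1 step i) = G i) ->
  exists2 x : {perm T}, perm_on O x & forall i, x (G i) = G (step i).
Proof.
move=> GO G_step G_iter.
have /choice[X XP] q : exists r, if q \in O then forall i, q = G i -> r = G (step i)
    else r = q.
  have [/GO[i ->]|_] := boolP (q \in O); last by exists q.
  by exists (G (step i)) => j /G_step.
have XG i : X (G i) = G (step i).
  have := XP (G i); have -> : G i \in O by apply/GO; exists i.
  exact.
have X_iter m i : iter m X (G i) = G (iter m step i).
  by elim: m => //= m ->; rewrite XG.
have X_out q : q \notin O -> X q = q by have := XP q; case: (q \in O).
have X_inj : injective X.
  apply: (@iter_id_inj _ _ n) => q; have [/GO[i ->]|qO] := boolP (q \in O).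
    by rewrite X_iter G_iter.
  suff X_id m : iter m X q = q by apply: X_id.
  by elim: m => //= m ->; apply: X_out.
exists (perm X_inj) => [|i]; last by rewrite permE XG.
by apply/subsetP => q; rewrite inE permE; apply: contraR => /X_out ->.
Qed.

Section Counting.
Variable T : finType.
Implicit Types (x z : {perm T}) (u : {perm T} * {perm T}) (O A : {set T}).

Definition commuting_pairs O : {set {perm T} * {perm T}} :=
  [set u | [&& perm_on O u.1, perm_on O u.2 & (u.1 * u.2 == u.2 * u.1)%g]].

Lemma commuting_pairsP O u : reflect
  [/\ perm_on O u.1, perm_on O u.2 & forall q, u.1 (u.2 q) = u.2 (u.1 q)]
  (u \in commuting_pairs O).
Proof.
rewrite inE; apply: (iffP and3P) => -[xO zO xz]; split=> //.
  by move=> q; rewrite -!permM (eqP xz).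
by apply/eqP/permP => q; rewrite !permM xz.
Qed.

Section Model.
Local Open Scope nat_scope.
Variables (a i k : nat) (f : {ffun 'I_a.+1 * 'I_i.+1 -> T}).
Hypothesis f_inj : injective f.

(* f extended to nat * nat, periodically modulo (0, i + 1) and (a + 1, - k). *)
Let G (rt : nat * nat) : T :=
  f (inord (rt.1 %% a.+1), inord ((rt.2 + rt.1 %/ a.+1 * k) %% i.+1)).

Let G_eq r t r' t' : G (r, t) = G (r', t') <->
  r = r' %[mod a.+1] /\ t + r %/ a.+1 * k = t' + r' %/ a.+1 * k %[mod i.+1].
Proof.
split=> [/f_inj[/(congr1 val) /= rr' /(congr1 val) /= tt']|[rr' tt']].
  by rewrite !inordK ?ltn_mod // in rr' tt'.
by rewrite /G /= rr' tt'.
Qed.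

(** Converse to [frame_exists]. The unit translations of nat * nat commute and respect both periods
    of G, hence descend to commuting permutations x and z of the image of f. *)
Lemma model_pair : exists u p,
  [/\ u \in commuting_pairs (f @: setT),
      forall (r : 'I_a.+1) (t : 'I_i.+1), iter t u.1 (iter r u.2 p) = f (r, t),
      fingraph.order u.1 p = i.+1 & iter a.+1 u.2 p = iter k u.1 p].
Proof.
set O := f @: setT.
have modS m m' d : m = m' %[mod d] -> m.+1 = m'.+1 %[mod d].
  by move=> mm'; rewrite -(addn1 m) -modnDml mm' modnDml addn1.
have GO q : q \in O <-> exists rt, q = G rt.
  split=> [/imsetP[[r t] _ ->]|[rt ->]]; last exact: imset_f.
  exists (r : nat, t : nat); rewrite /G /= divn_small // addn0.
  by rewrite !modn_small // !inord_val.
have [x xO xG] : exists2 x : {perm T}, perm_on O x &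
    forall rt, x (G rt) = G (rt.1, rt.2.+1).
  apply: (@step_perm _ _ G (fun rt => (rt.1, rt.2.+1)) _ i) => //.
    move=> [r t] [r' t'] /G_eq[rr' tt']; apply/G_eq; split=> //=.
    exact: modS.
  move=> [r t].
  have -> n : iter n (fun rt => (rt.1, rt.2.+1)) (r, t) = (r, t + n)%N.
    by elim: n => [|n /= ->]; rewrite ?addn0 ?addnS.
  by apply/G_eq; split=> //; rewrite addnAC modnDr.
(* z^(a+1) acts as x^k, and x^(i+1) is the identity, so z^((a+1)(i+1)) is the identity. *)
have [z zO zG] : exists2 z : {perm T}, perm_on O z &
    forall rt, z (G rt) = G (rt.1.+1, rt.2).
  apply: (@step_perm _ _ G (fun rt => (rt.1.+1, rt.2)) _ (a.+1 * i.+1).-1) => //.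
    move=> [r t] [r' t'] /G_eq[rr' tt']; apply/G_eq => /=.
    have dvdS : (a.+1 %| r.+1) = (a.+1 %| r'.+1)%N.
      by rewrite /dvdn (modS _ _ _ rr').
    rewrite !modnS !divnS // dvdS rr' !mulnDl ![(t + _)%N]addnCA ![(t' + _)%N]addnCA.
    by split=> //; rewrite -modnDmr tt' modnDmr.
  move=> [r t]; rewrite prednK ?muln_gt0 //.
  have -> n : iter n (fun rt => (rt.1.+1, rt.2)) (r, t) = (r + n, t)%N.
    by elim: n => [|n /= ->]; rewrite ?addn0 ?addnS.
  apply/G_eq; split; first by rewrite (mulnC a.+1) addnC modnMDl.
  rewrite (mulnC a.+1) divnDMl // mulnDl addnA (mulnC i.+1).
  by rewrite addnC modnMDl.
have xzG r t : iter t x (iter r z (G (0%N, 0%N))) = G (r, t).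
  have -> : iter r z (G (0%N, 0%N)) = G (r, 0%N).
    by elim: r => //= r ->; rewrite zG.
  by elim: t => //= t ->; rewrite xG.
exists (x, z), (G (0%N, 0%N)); split.
- apply/commuting_pairsP; split=> // q /=.
  have [/GO[rt ->]|qO] := boolP (q \in O); first by rewrite zG !xG zG.
  by rewrite (out_perm zO qO) (out_perm xO qO) (out_perm zO qO).
- move=> r t; rewrite xzG /G /= divn_small // addn0.
  by rewrite !modn_small // !inord_val.
- have xE n : iter n x (G (0%N, 0%N)) = G (0%N, n) by apply: (xzG 0%N).
  apply/eqP; rewrite [(x, z).1]/= eqn_dvd order_dvdn; last exact: perm_inj.
  apply/andP; split; first by rewrite xE; apply/eqP/G_eq; rewrite div0n addn0 modnn.
  rewrite /dvdn -(mod0n i.+1); apply/eqP.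
  have /G_eq[_] : G (0%N, fingraph.order x (G (0%N, 0%N))) = G (0%N, 0%N).
    by rewrite -xE iter_order //; apply: perm_inj.
  by rewrite !addn0.
rewrite [(x, z).1]/= [(x, z).2]/=.
transitivity (G (a.+1, 0)); [exact: (xzG a.+1 0) | rewrite (xzG 0 k)].
by apply/G_eq; rewrite modnn mod0n divnn div0n mul1n mul0n add0n addn0.
Qed.

End Model.
(** The number of rows is forced to be [#|O| %/ i] by [frame_dvdn], so i and k are the only
    parameters of a transitive pair with base point. *)
Definition framed O (i k : nat) : {set ({perm T} * {perm T}) * T} :=
  [set v | [&& v.1 \in commuting_pairs O, orbit2 v.1.1 v.1.2 v.2 == O,
    fingraph.order v.1.1 v.2 == i &
    findex v.1.1 v.2 (iter (#|O| %/ i) v.1.2 v.2) == k]].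

Lemma framed_commuting O i k v : v \in framed O i k -> v.1 \in commuting_pairs O.
Proof. by rewrite inE => /and4P[]. Qed.

Lemma framedP O i k v : v \in framed O i k ->
  frame v.1.1 v.1.2 v.2 (#|O| %/ i) i k O.
Proof.
rewrite inE => /and4P[/commuting_pairsP[_ _ xz] /eqP vO /eqP vi /eqP <-].
have [a F] := frame_exists v.2 xz.
by have := F; rewrite -(frame_dvdn F) vO vi.
Qed.

(** Sending (x, z, p) to its grid is a bijection onto the injections of the index rectangle into O,
    which has the same cardinality; there are (#|O|)! of them. *)
Lemma card_framed O a i k : #|O| = (a.+1 * i.+1)%N -> (k < i.+1)%N ->
  #|framed O i.+1 k| = (#|O|)`!.
Proof.
move=> cO ki; have aE : (#|O| %/ i.+1 = a.+1)%N by rewrite cO mulnK.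
pose Phi (v : ({perm T} * {perm T}) * T) := [ffun rt : 'I_a.+1 * 'I_i.+1 =>
  iter rt.2 v.1.1 (iter rt.1 v.1.2 v.2)].
have PhiP v : v \in framed O i.+1 k -> frame v.1.1 v.1.2 v.2 a.+1 i.+1 k O.
  by move/framedP; rewrite aE.
rewrite -(@card_in_imset _ _ Phi) => [|v v' vF v'F /ffunP eqPhi].
  have -> : [set Phi v | v in framed O i.+1 k] =
            [set f in ffun_on [in O] | injectiveb f].
    apply/setP=> f; rewrite !inE; apply/imsetP/andP => [[v vF ->]|[/ffun_onP fO /injectiveP f_inj]].
      have F := PhiP _ vF; split.
        apply/ffun_onP => -[r t]; rewrite ffunE /=.
        by apply/(frame_mem F); exists r, t.
      apply/injectiveP => -[r t] [r' t']; rewrite !ffunE /=.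
      move=> /(frame_inj F (ltn_ord r) (ltn_ord t) (ltn_ord r') (ltn_ord t')).
      by case=> /val_inj -> /val_inj ->.
    have [u [p [uO ptE u_i u_ret]]] := model_pair k f_inj.
    have fOE : f @: [set: 'I_a.+1 * 'I_i.+1] = O.
      apply/eqP; rewrite eqEcard card_imset // cardsT card_prod !card_ord cO leqnn andbT.
      by apply/subsetP => _ /imsetP[rt _ ->]; apply: fO.
    rewrite fOE in uO; exists (u, p); last first.
      by apply/ffunP => -[r t]; rewrite ffunE /= ptE.
    have [xO zO xz] := commuting_pairsP _ _ uO.
    rewrite inE /= uO aE u_i u_ret findex_iter ?u_i // !eqxx !andbT /=.
    rewrite eq_sym eqEcard; apply/andP; split.
      rewrite -fOE; apply/subsetP => _ /imsetP[[r t] _ ->]; rewrite -ptE.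
      by apply/orbit2P; exists r, t.
    apply/subset_leq_card/subsetP => _ /orbit2P[r [t ->]].
    have pO : p \in O by have := fO (ord0, ord0); rewrite -ptE.
    elim: t => [|t]; last by rewrite /= perm_closed.
    by elim: r => //= r; rewrite perm_closed.
  by rewrite card_inj_ffuns_on card_prod !card_ord -cO ffactnn.
have F := PhiP _ vF; have F' := PhiP _ v'F.
(* The grids only record t <= i. Reducing t modulo the order of p extends their equality to all t,
   as needed for x at the end of a row and for z in the last row. *)
have ptE r t : (r < a.+1)%N ->
    iter t v.1.1 (iter r v.1.2 v.2) = iter t v'.1.1 (iter r v'.1.2 v'.2).
  have /commuting_pairsP[_ _ xz] := framed_commuting vF.
  have /commuting_pairsP[_ _ xz'] := framed_commuting v'F; move=> ra.
  rewrite (iter_reduce xz _ _ (frame_return F)) (iter_reduce xz' _ _ (frame_return F')).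
  rewrite (frame_order F) (frame_order F') (divn_small ra) (modn_small ra).
  have := eqPhi (Ordinal ra, Ordinal (ltn_pmod (t + 0 * k) (ltn0Sn i))).
  by rewrite !ffunE.
have pE : v.2 = v'.2 := ptE 0%N 0%N isT.
case: v v' vF v'F F F' ptE pE {eqPhi} => [[x z] p] [[x' z'] p'] /=.
move=> /framed_commuting/commuting_pairsP[/= xO zO xz].
move=> /framed_commuting/commuting_pairsP[/= x'O z'O xz'] F F' ptE pE.
congr (_, _, _) => //; apply/permP => q.
  have [/(frame_mem F)[r [t [ra _ ->]]]|qO] := boolP (q \in O).
    by rewrite {2}ptE //; apply: (ptE r t.+1).
  by rewrite (out_perm xO qO) (out_perm x'O qO).
have [/(frame_mem F)[r [t [ra _ ->]]]|qO] := boolP (q \in O); last first.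
  by rewrite (out_perm zO qO) (out_perm z'O qO).
rewrite {2}ptE //.
have -> : z (iter t x (iter r z p)) = iter t x (iter r.+1 z p).
  exact/esym/(perm_iter_comm xz t 1).
have -> : z' (iter t x' (iter r z' p')) = iter t x' (iter r.+1 z' p').
  exact/esym/(perm_iter_comm xz' t 1).
(* From the last row z leaves the grid and re-enters row 0, shifted by k; the common value of k
   makes the two pairs agree there as well. *)
move: ra; rewrite ltnS leq_eqVlt => /orP[/eqP->|ra]; last exact: ptE.
rewrite (frame_return F) (frame_return F') -!iterD.
exact: (ptE 0%N).
Qed.

End Counting.

(** * Decomposition into orbits *)

Section Gluing.
Variable T : finType.
Implicit Types (O A B : {set T}) (a b x z : {perm T}).

Lemma perm_on_mull O B a b q : perm_on O a -> perm_on B b -> [disjoint O & B] ->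
  q \in O -> (a * b)%g q = a q.
Proof.
move=> aO bB dOB qO; rewrite permM (out_perm bB) //.
by rewrite (disjointFr dOB) // perm_closed.
Qed.

Lemma perm_on_mulr O B a b q : perm_on O a -> perm_on B b -> [disjoint O & B] ->
  q \in B -> (a * b)%g q = b q.
Proof. by move=> aO bB dOB qB; rewrite permM (out_perm aO) // (disjointFl dOB). Qed.

Lemma perm_on_mul_out O B a b q : perm_on O a -> perm_on B b ->
  q \notin O -> q \notin B -> (a * b)%g q = q.
Proof. by move=> aO bB qO qB; rewrite permM (out_perm aO) // (out_perm bB). Qed.

Lemma perm_stabP O a : reflect (forall q, q \in O -> a q \in O) (a \in 'N(O | 'P)%g).
Proof.
apply: (iffP idP) => [/astabsP aO q qO|aO]; first by have := aO q; rewrite /= apermE => ->.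
rewrite inE; apply/andP; split; first by rewrite inE.
by rewrite inE; apply/subsetP => q qO; rewrite inE; apply: aO.
Qed.

Lemma perm_stabD A O a : perm_on A a -> a \in 'N(O | 'P)%g ->
  a \in 'N(A :\: O | 'P)%g.
Proof.
move=> aA /astabsP aO; apply/perm_stabP => q; rewrite !inE (perm_closed _ aA).
by have := aO q; rewrite /= apermE => ->.
Qed.

Lemma restr_perm_mul O B a b : perm_on O a -> perm_on B b -> [disjoint O & B] ->
  restr_perm O (a * b) = a /\ restr_perm B (a * b) = b.
Proof.
move=> aO bB dOB; split; apply/permP => q.
  have [qO|qO] := boolP (q \in O); last first.
    by rewrite (out_perm (restr_perm_on _ _) qO) (out_perm aO qO).
  rewrite restr_permE ?(perm_on_mull aO bB) //; apply/perm_stabP => r rO.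
  by rewrite (perm_on_mull aO bB) // perm_closed.
have [qB|qB] := boolP (q \in B); last first.
  by rewrite (out_perm (restr_perm_on _ _) qB) (out_perm bB qB).
rewrite restr_permE ?(perm_on_mulr aO bB) //; apply/perm_stabP => r rB.
by rewrite (perm_on_mulr aO bB) // perm_closed.
Qed.

Lemma restr_permK A O a : O \subset A -> perm_on A a -> a \in 'N(O | 'P)%g ->
  (restr_perm O a * restr_perm (A :\: O) a)%g = a.
Proof.
move=> OA aA aO; have aB := perm_stabD aA aO; apply/permP => q.
have dOB : [disjoint O & A :\: O].
  by rewrite -setI_eq0 setIDA setIC -setIDA setDv setI0.
have [qO|qO] := boolP (q \in O).
  by rewrite (perm_on_mull (restr_perm_on _ _) (restr_perm_on _ _)) ?restr_permE.
have [qB|qB] := boolP (q \in A :\: O).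
  by rewrite (perm_on_mulr (restr_perm_on _ _) (restr_perm_on _ _)) ?restr_permE.
rewrite (perm_on_mul_out (restr_perm_on _ _) (restr_perm_on _ _)) // (out_perm aA) //.
by apply: contra qB; rewrite inE qO.
Qed.

Lemma eq_in_orbit2 O x z (x1 z1 : {perm T}) p : p \in O ->
  (forall q, q \in O -> x q \in O) -> (forall q, q \in O -> x q = x1 q) ->
  (forall q, q \in O -> z q \in O) -> (forall q, q \in O -> z q = z1 q) ->
  orbit2 x z p = orbit2 x1 z1 p.
Proof.
move=> pO xO xx1 zO zz1; apply/setP=> q.
apply/orbit2P/orbit2P => -[r [t ->]]; exists r, t.
  by rewrite -(eq_in_iter zO zz1) // -(eq_in_iter xO xx1) // iter_stable.
by rewrite -(eq_in_iter zO zz1) // -(eq_in_iter xO xx1) // iter_stable.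
Qed.

Lemma orbit2_stable x z p : (forall q, x (z q) = z (x q)) ->
  (forall q, q \in orbit2 x z p -> x q \in orbit2 x z p) /\
  (forall q, q \in orbit2 x z p -> z q \in orbit2 x z p).
Proof.
by move=> xz; have [a F] := frame_exists p xz; apply: frame_stable F.
Qed.

Lemma orbit2_id x z p : p \in orbit2 x z p.
Proof. by apply/orbit2P; exists 0%N, 0%N. Qed.

Lemma commuting_pairsU O B (u v : {perm T} * {perm T}) : [disjoint O & B] ->
  perm_on O u.1 -> perm_on O u.2 -> perm_on B v.1 -> perm_on B v.2 ->
  ((u.1 * v.1)%g, (u.2 * v.2)%g) \in commuting_pairs (O :|: B) =
  (u \in commuting_pairs O) && (v \in commuting_pairs B).
Proof.
case: u v => [x1 z1] [x2 z2] /= dOB x1O z1O x2B z2B.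
have xO q : q \in O -> (x1 * x2)%g q = x1 q by apply: perm_on_mull dOB.
have zO q : q \in O -> (z1 * z2)%g q = z1 q by apply: perm_on_mull dOB.
have xB q : q \in B -> (x1 * x2)%g q = x2 q by apply: perm_on_mulr dOB.
have zB q : q \in B -> (z1 * z2)%g q = z2 q by apply: perm_on_mulr dOB.
have onU a b : perm_on O a -> perm_on B b -> perm_on (O :|: B) (a * b)%g.
  move=> aO bB; apply: perm_onM; [apply: subset_trans aO _|apply: subset_trans bB _].
    exact: subsetUl.
  exact: subsetUr.
apply/commuting_pairsP/andP => [[/= _ _ xz]|].
  split; apply/commuting_pairsP; split=> //= q.
    have [qO|qO] := boolP (q \in O); last first.
      by rewrite (out_perm x1O qO) (out_perm z1O qO) (out_perm x1O qO).
    by have := xz q; rewrite (zO q) // (xO q) // xO ?zO ?perm_closed.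
  have [qB|qB] := boolP (q \in B); last first.
    by rewrite (out_perm x2B qB) (out_perm z2B qB) (out_perm x2B qB).
  by have := xz q; rewrite (zB q) // (xB q) // xB ?zB ?perm_closed.
move=> [/commuting_pairsP[/= _ _ xz1] /commuting_pairsP[/= _ _ xz2]].
split; rewrite /= ?onU // => q.
have [qO|qO] := boolP (q \in O).
  by rewrite (zO q) // (xO q) // xO ?zO ?perm_closed.
have [qB|qB] := boolP (q \in B).
  by rewrite (zB q) // (xB q) // xB ?zB ?perm_closed.
rewrite (perm_on_mul_out x1O x2B qO qB) (perm_on_mul_out z1O z2B qO qB).
by rewrite (perm_on_mul_out x1O x2B qO qB).
Qed.

End Gluing.

(** * The recurrence for the total weight of commuting pairs *)

Section Recursion.
Variables (zeta : nat -> algC) (R : comAlgType algC) (s t : nat -> R).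
Hypothesis zeta_prim : forall i, (0 < i)%N -> i.-primitive_root (zeta i).
Variable T : finType.
Implicit Types (O A : {set T}) (p : T) (u : {perm T} * {perm T}).

Definition pair_weight A u : R :=
  \prod_(q in A) point_weight zeta s t u.1 u.2 q.

Definition pair_sum A : R := \sum_(u in commuting_pairs A) pair_weight A u.

Definition orbit_sum O p : R :=
  \sum_(u in commuting_pairs O | orbit2 u.1 u.2 p == O) pair_weight O u.

(** The index i = 0 divides only m = 0, where the inner sum is empty; hence the value 0 at m = 0. *)
Definition connected_term (m : nat) : R :=
  \sum_(i < m.+1 | (i %| m)%N) \sum_(k < i)
    zeta i ^+ k *: (s i ^+ (m %/ i) * t (m %/ gcdn i k) ^+ gcdn i k).

Lemma connected_term0 : connected_term 0 = 0.
Proof. by rewrite /connected_term big1 // => i _; rewrite (ord1 i) big_ord0. Qed.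

(** Once the orbit O of p is fixed, restriction to O and to [A :\: O] is inverse to multiplication
    of pairs with disjoint supports. The weight splits along with the pair because each
    [point_weight] is local. *)
Lemma pair_sum_orbit A p : p \in A ->
  pair_sum A = \sum_(O : {set T} | (O \subset A) && (p \in O))
    orbit_sum O p * pair_sum (A :\: O).
Proof.
move=> pA; rewrite /pair_sum.
rewrite (partition_big (fun u => orbit2 u.1 u.2 p)
   (fun O => (O \subset A) && (p \in O))) /=; last first.
  move=> u /commuting_pairsP[xA zA xz]; rewrite orbit2_id andbT.
  apply/subsetP => _ /orbit2P[r [n ->]].
  elim: n => [|n]; last by rewrite /= perm_closed.
  by elim: r => //= r; rewrite perm_closed.
apply: eq_bigr => O /andP[OA pO]; set B := A :\: O.
have dOB : [disjoint O & B].
  by rewrite -setI_eq0 setIDA setIC -setIDA setDv setI0.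
have AE : A = O :|: B.
  by apply/setP=> q; rewrite !inE; have [/(subsetP OA)->|] := boolP (q \in O).
rewrite big_distrlr /= pair_big_dep /=.
pose h (w : ({perm T} * {perm T}) * ({perm T} * {perm T})) :=
  ((w.1.1 * w.2.1)%g, (w.1.2 * w.2.2)%g).
pose h' (u : {perm T} * {perm T}) := ((restr_perm O u.1, restr_perm O u.2),
  (restr_perm B u.1, restr_perm B u.2)).
rewrite (reindex_onto h h') /=; last first.
  move=> [x z] /andP[/commuting_pairsP[/= xA zA xz] /eqP orbE].
  have [xO zO] := orbit2_stable p xz; rewrite orbE in xO zO.
  by rewrite /h /= !restr_permK //; apply/perm_stabP.
apply: eq_big => [[[x1 z1] [x2 z2]]|[[x1 z1] [x2 z2]]] /=.
  rewrite [in LHS]AE /h /=.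
  apply/idP/idP => [/andP[/andP[wA orbE] /eqP[e1 e2 e3 e4]]|].
    have x1O : perm_on O x1 by rewrite -e1 restr_perm_on.
    have z1O : perm_on O z1 by rewrite -e2 restr_perm_on.
    have x2B : perm_on B x2 by rewrite -e3 restr_perm_on.
    have z2B : perm_on B z2 by rewrite -e4 restr_perm_on.
    move: wA; rewrite (@commuting_pairsU _ _ _ (x1, z1) (x2, z2)) // => /andP[-> ->].
    rewrite andbT /= -(eqP orbE); apply/eqP/esym/(@eq_in_orbit2 _ O) => // q qO.
    - by rewrite (perm_on_mull x1O x2B) ?perm_closed.
    - by rewrite (perm_on_mull x1O x2B).
    - by rewrite (perm_on_mull z1O z2B) ?perm_closed.
    - by rewrite (perm_on_mull z1O z2B).
  move=> /andP[/andP[w1 orbE] w2].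
  have [/= x1O z1O _] := commuting_pairsP _ _ w1.
  have [/= x2B z2B _] := commuting_pairsP _ _ w2.
  rewrite (@commuting_pairsU _ _ _ (x1, z1) (x2, z2)) // w1 w2 /h' /=.
  have [-> ->] := restr_perm_mul x1O x2B dOB.
  have [-> ->] := restr_perm_mul z1O z2B dOB; rewrite eqxx andbT.
  rewrite -(eqP orbE); apply/eqP/(@eq_in_orbit2 _ O) => // q qO.
  - by rewrite (perm_on_mull x1O x2B) ?perm_closed.
  - by rewrite (perm_on_mull x1O x2B).
  - by rewrite (perm_on_mull z1O z2B) ?perm_closed.
  - by rewrite (perm_on_mull z1O z2B).
move=> /andP[_ /eqP[e1 e2 e3 e4]].
have x1O : perm_on O x1 by rewrite -e1 restr_perm_on.
have z1O : perm_on O z1 by rewrite -e2 restr_perm_on.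
have x2B : perm_on B x2 by rewrite -e3 restr_perm_on.
have z2B : perm_on B z2 by rewrite -e4 restr_perm_on.
rewrite /pair_weight (big_setID O) /= (setIidPr OA); congr (_ * _).
  apply: eq_bigr => q qO; apply: (@eq_in_point_weight _ _ _ _ _ O) => // r rO.
  - by rewrite (perm_on_mull x1O x2B) ?perm_closed.
  - by rewrite (perm_on_mull x1O x2B).
  - by rewrite (perm_on_mull z1O z2B) ?perm_closed.
  - by rewrite (perm_on_mull z1O z2B).
apply: eq_bigr => q qB; apply: (@eq_in_point_weight _ _ _ _ _ B) => // r rB.
- by rewrite (perm_on_mulr x1O x2B) ?perm_closed.
- by rewrite (perm_on_mulr x1O x2B).
- by rewrite (perm_on_mulr z1O z2B) ?perm_closed.
- by rewrite (perm_on_mulr z1O z2B).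
Qed.

(** The sum runs over triples (x, z, p). Grouped by (i, k) they form the sets [framed O i k], each
    of (#|O|)! elements with the same weight. *)
Lemma sum_orbit_sum O : (0 < #|O|)%N ->
  \sum_(p in O) orbit_sum O p = (#|O|)`!%:R *: connected_term #|O|.
Proof.
set m := #|O| => m0.
(* The range of k depends on i; both are moved into 'I_m.+1 so that (i, k) can index a partition of
   the triples. By [keyP] the use of [inord] in the key loses nothing. *)
have -> : connected_term m = \sum_(ik : 'I_m.+1 * 'I_m.+1 |
    (ik.1 %| m)%N && (ik.2 < ik.1)%N) zeta ik.1 ^+ ik.2 *:
      (s ik.1 ^+ (m %/ ik.1) * t (m %/ gcdn ik.1 ik.2) ^+ gcdn ik.1 ik.2).
  rewrite /connected_term -(pair_big_dep (fun i : 'I_m.+1 => i %| m)%N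
    (fun i k : 'I_m.+1 => k < i)%N (fun i k : 'I_m.+1 => zeta i ^+ k *:
      (s i ^+ (m %/ i) * t (m %/ gcdn i k) ^+ gcdn i k))) /=.
  apply: eq_bigr => i _; rewrite (big_ord_widen m.+1 (fun k => zeta i ^+ k *:
      (s i ^+ (m %/ i) * t (m %/ gcdn i k) ^+ gcdn i k))) //.
  exact/ltnW/ltn_ord.
rewrite (exchange_big_dep [in commuting_pairs O]) /=; last by move=> p u _ /andP[].
rewrite pair_big_dep /=.
pose key (v : ({perm T} * {perm T}) * T) : 'I_m.+1 * 'I_m.+1 :=
  let i := fingraph.order v.1.1 v.2 in
  (inord i, inord (findex v.1.1 v.2 (iter (m %/ i) v.1.2 v.2))).
have keyP v : v.1 \in commuting_pairs O -> orbit2 v.1.1 v.1.2 v.2 = O ->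
    let i := fingraph.order v.1.1 v.2 in
    let k := findex v.1.1 v.2 (iter (m %/ i) v.1.2 v.2) in
    [/\ (i %| m)%N, (k < i)%N & (i <= m)%N].
  move=> /commuting_pairsP[_ _ vC] vO i.
  have [a F] := frame_exists v.2 vC; rewrite vO -/i in F.
  have aE := frame_dvdn F; rewrite -/m in aE; rewrite aE.
  have i_m : (i %| m)%N by rewrite /m (frame_card F) dvdn_mull.
  by split; rewrite ?(frame_lt F) // dvdn_leq.
rewrite (partition_big key (fun ik => (ik.1 %| m)%N && (ik.2 < ik.1)%N)) /=; last first.
  move=> v /andP[vC /andP[vp /andP[_ /eqP vO]]].
  have [] := keyP _ vC vO; set i := fingraph.order _ _ => im ki i_le.
  by rewrite !inordK ?ltnS // ?(leq_trans (ltnW ki)) // im ki.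
rewrite scaler_sumr; apply: eq_bigr => -[i k] /andP[/= im ki].
have i0 : (0 < i)%N by exact: leq_ltn_trans ki.
rewrite (eq_bigl [in framed O i k]) => [|v]; last first.
  rewrite [in RHS]inE; have [vC|] := boolP (v.1 \in commuting_pairs O) => //=.
  have [vO|] := eqVneq (orbit2 v.1.1 v.1.2 v.2) O; last by rewrite !andbF.
  have -> : v.2 \in O by rewrite -vO orbit2_id.
  have [_ k_lt i_le] := keyP _ vC vO; rewrite xpair_eqE -!val_eqE /=.
  rewrite !inordK ?ltnS // ?(leq_trans (ltnW k_lt)) // -/m.
  by case: eqP => [->|].
rewrite (eq_bigr (fun=> zeta i ^+ k *:
    (s i ^+ (m %/ i) * t (m %/ gcdn i k) ^+ gcdn i k))) => [|v vF].
  rewrite sumr_const scaler_nat; congr (_ *+ _).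
  rewrite -(prednK i0) in ki *; apply: (@card_framed _ _ (m %/ i).-1) => //.
  by rewrite !prednK ?divnK // divn_gt0 // dvdn_leq.
have /commuting_pairsP[_ _ vC] := framed_commuting vF.
exact: (frame_weight vC (framedP vF)).
Qed.

(** Peeling at every p in A and summing makes each O appear with all its base points, so that only
    the sum of [orbit_sum O p] over p in O is needed. The binomial(n, m) subsets O of size m then
    absorb m! (n-m)! into n!. *)
Lemma pair_sum_rec (a : nat -> R) : a 0%N = 1 ->
  (forall n, n%:R *: a n = \sum_(m < n.+1) connected_term m * a (n - m)%N) ->
  forall A, pair_sum A = (#|A|)`!%:R *: a #|A|.
Proof.
move=> a0 a_rec A; move: {2}#|A| (leqnn #|A|) => N.
elim: N A => [|N IHN] A.
  rewrite leqn0 cards_eq0 => /eqP ->; rewrite cards0 a0 scale1r.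
  rewrite /pair_sum (big_pred1 (1%g, 1%g)) => [|[x z]].
    by rewrite /pair_weight big_set0.
  rewrite /= inE /= xpair_eqE.
  have on0 (y : {perm T}) : perm_on set0 y = (y == 1%g).
    apply/idP/eqP => [y0|->]; last exact: perm_on1.
    by apply/permP => q; rewrite perm1 (out_perm y0) ?inE.
  rewrite !on0; case: eqP => //= ->; case: eqP => //= ->; exact: eqxx.
move=> AN; have [A0|A_gt0] := posnP #|A|; first by apply: IHN; rewrite A0.
set n := #|A|; have n0 : (n%:R : algC) != 0 by rewrite pnatr_eq0 -lt0n.
apply: (scalerI n0).
transitivity (\sum_(p in A) pair_sum A); first by rewrite sumr_const scaler_nat.
rewrite (eq_bigr _ (fun p pA => pair_sum_orbit pA)).
rewrite (exchange_big_dep (fun O : {set T} => O \subset A)) /=; last by move=> p O _ /andP[].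
transitivity (\sum_(O : {set T} | O \subset A)
    ((#|O|)`! * (n - #|O|)`!)%:R *: (connected_term #|O| * a (n - #|O|)%N)).
  apply: eq_bigr => O OA.
  rewrite (eq_bigl [in O]) => [|p]; last first.
    by have [/(subsetP OA)->|] := boolP (p \in O); rewrite ?OA ?andbF.
  (* The empty O contributes 0 on both sides; it is kept so that m ranges over all of 0..n, as in
     the recurrence for a. *)
  rewrite -big_distrl /=; have [O0|O_gt0] := posnP #|O|.
    rewrite O0 connected_term0 mul0r scaler0; move/eqP: O0.
    by rewrite cards_eq0 => /eqP ->; rewrite big_set0 mul0r.
  rewrite sum_orbit_sum // IHN cardsD (setIidPr OA) -?/n; last first.
    by rewrite -ltnS (leq_trans _ AN) // ltn_subrL O_gt0.
  by rewrite -scalerAl -scalerAr scalerA -natrM.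
rewrite scalerA mulrC -scalerA a_rec scaler_sumr.
rewrite (partition_big (fun O : {set T} => inord #|O| : 'I_n.+1) xpredT) //=.
apply: eq_bigr => m _; have mn : (m <= n)%N by rewrite -ltnS.
rewrite (eq_bigl [in [set O : {set T} | (O \subset A) && (#|O| == m)]]) => [|O].
  rewrite (eq_bigr (fun=> (m`! * (n - m)`!)%:R *: (connected_term m * a (n - m)%N))).
    by rewrite sumr_const cards_draws -/n -scaler_nat scalerA -natrM bin_fact.
  by move=> O; rewrite inE => /andP[_ /eqP ->].
rewrite inE; case OA: (O \subset A) => //=.
by rewrite -val_eqE /= inordK // ltnS subset_leq_card.
Qed.

End Recursion.

(** * Cycle types and class sums *)

(** Serves to match the cycles of two permutations by length. The element of J is the value of h
    outside r. *)
Lemma perm_eq_map_inj (I J : eqType) (S : eqType) (f : I -> S) (g : J -> S)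
    (r : seq I) (r' : seq J) : uniq r -> uniq r' ->
  perm_eq (map f r) (map g r') -> J ->
  exists2 h : I -> J, {in r, forall i, h i \in r' /\ g (h i) = f i} &
    {in r &, injective h}.
Proof.
move=> + + + j0; elim: r r' => [|i r IHr] r' /=; first by exists (fun=> j0).
move=> /andP[ir r_uniq] r'_uniq eq_fg.
have /mapP[j jr' fE] : f i \in map g r' by rewrite -(perm_mem eq_fg) mem_head.
have r'E := perm_to_rem jr'.
have [||h hP h_inj] := IHr (rem j r') r_uniq; first exact: rem_uniq.
  rewrite -(perm_cons (f i)) (perm_trans eq_fg) // fE.
  by rewrite -(map_cons g) perm_map.
exists (fun k => if k == i then j else h k).
  move=> k; rewrite inE; case: eqVneq => [-> _ //|_ /= kr].
  by have [hk ->] := hP _ kr; split=> //; apply: mem_rem hk.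
have h_neq k : k \in r -> h k != j.
  by case/hP => + _; rewrite mem_rem_uniq // inE => /andP[].
move=> k l; rewrite !inE; case: eqVneq => [->|_] /=; case: eqVneq => [->|_] //=.
- by move=> _ lr /eqP; rewrite eq_sym (negPf (h_neq _ lr)).
- by move=> kr _ /eqP; rewrite (negPf (h_neq _ kr)).
exact: h_inj.
Qed.

Section CycleType.
Variable n : nat.
Implicit Types (x y z g : 'S_n) (q : 'I_n).

Lemma mem_porbit_fconnect x q r : (r \in porbit x q) = fconnect x q r.
Proof.
apply/porbitP/fconnect_iterP => -[k ->]; exists k; first exact: permX.
by rewrite permX.
Qed.

Lemma froots_froot x q : froots x (froot x q).
Proof. by rewrite /roots /= root_root //; apply/fconnect_sym/perm_inj. Qed.

Lemma card_porbit x q : #|porbit x q| = fingraph.order x q.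
Proof. by apply: eq_card => r; rewrite mem_porbit_fconnect. Qed.

Lemma cycle_type_froots x :
  perm_eq (cycle_type x) [seq fingraph.order x q | q <- enum (froots x)].
Proof.
rewrite /cycle_type perm_sort.
have -> : [seq fingraph.order x q | q <- enum (froots x)] =
    [seq #|pred_of_set c| | c <- [seq porbit x q | q <- enum (froots x)]].
  by rewrite -map_comp; apply: eq_map => q /=; rewrite card_porbit.
apply: perm_map; apply: uniq_perm; rewrite ?enum_uniq //.
  rewrite map_inj_in_uniq ?enum_uniq // => q r; rewrite !mem_enum => /eqP qr /eqP rr /eqP.
  rewrite eq_porbit_mem mem_porbit_fconnect -root_connect; last exact/fconnect_sym/perm_inj.
  by rewrite qr rr => /eqP.
move=> c; rewrite mem_enum; apply/imsetP/mapP => [[q _ ->]|[q _ ->]]; last by exists q.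
exists (froot x q); first by rewrite mem_enum; apply: froots_froot.
apply/eqP; rewrite eq_porbit_mem mem_porbit_fconnect fconnect_sym ?connect_root //.
exact: perm_inj.
Qed.

Lemma sum_order_froots x : (\sum_(q | froots x q) fingraph.order x q = n)%N.
Proof.
rewrite -[RHS]card_ord -sum1_card [RHS](partition_big (froot x) (froots x)) /=; last first.
  by move=> q _; apply: froots_froot.
apply: eq_bigr => q /eqP qr; rewrite sum1_card; apply: eq_card => r.
apply: (@etrans _ _ (froot x r == q)); last by [].
rewrite -{2}qr root_connect; last exact/fconnect_sym/perm_inj.
by rewrite fconnect_sym //; apply: perm_inj.
Qed.

Lemma cycle_typeP x : is_intpart n (cycle_type x).
Proof.
apply/and3P; split.
- by apply: sort_sorted => a b; apply: leq_total.
- rewrite (perm_mem (cycle_type_froots x)); apply/mapP => -[q _ q0].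
  by have := fingraph.order_gt0 x q; rewrite -q0.
rewrite sumnE (perm_big _ (cycle_type_froots x)) big_map big_enum.
by rewrite sum_order_froots.
Qed.

Lemma intpart_ex (l : seq nat) : is_intpart n l -> exists la : intpart n, la = l :> seq nat.
Proof.
move=> l_part; have /and3P[_ l0 /eqP ln] := l_part.
have le_n i : i \in l -> (i <= n)%N.
  by move=> il; rewrite -ln sumnE (big_rem i) //= leq_addr.
have size_l : (size (map (inord : nat -> 'I_n.+1) l) <= n)%N.
  rewrite size_map -ln sumnE -sum1_size big_seq [leqRHS]big_seq.
  by apply: leq_sum => i il; rewrite lt0n; apply: contraNneq l0 => <-.
have lE : map val (Bseq size_l) = l.
  rewrite /= -map_comp -[RHS]map_id; apply/eq_in_map => i il /=.
  by rewrite inordK // ltnS le_n.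
have p : is_intpart n (map val (Bseq size_l)) by rewrite lE.
by exists (IntPart p); rewrite /parts /= -[RHS]lE.
Qed.

Lemma parts_inj : injective (@parts n).
Proof. by move=> la nu /(inj_map val_inj)/val_inj/val_inj. Qed.

(** Roots of x are matched with roots of y of the same cycle length, and the matching is extended
    along the cycles by labels. *)
Lemma eq_cycle_type_conj x y : cycle_type x = cycle_type y -> exists g, y = (x ^ g)%g.
Proof.
move=> xy; have := cycle_type_froots x; rewrite xy perm_sym.
move=> /perm_trans/(_ (cycle_type_froots y)) xy_froots.
(* The matching of roots needs an inhabitant of 'I_n, so n = 0 is treated apart. *)
have [n0|n_gt0] := posnP n.
  exists 1%g; apply/permP => q; suff: false by [].
  by rewrite -[false](ltn0 q) -[X in (_ < X)%N]n0 ltn_ord.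
have [|h hP h_inj] := perm_eq_map_inj (enum_uniq _) (enum_uniq _) xy_froots.
  exact: Ordinal n_gt0.
pose X q := iter (cycle_label x q) y (h (froot x q)).
have hR q : froot y (h (froot x q)) = h (froot x q) /\
    fingraph.order y (h (froot x q)) = fingraph.order x q.
  have [|hr ->] := hP (froot x q); first by rewrite mem_enum; apply: froots_froot.
  by rewrite order_froot; split=> //; apply/eqP; move: hr; rewrite mem_enum.
have label_lt q : (cycle_label x q < fingraph.order x q)%N.
  rewrite -(order_froot x q); apply: findex_max; rewrite fconnect_sym ?connect_root //.
  exact: perm_inj.
have X_inj : injective X.
  move=> q r qr; have := congr1 (froot y) qr.
  rewrite /X !froot_iter (hR q).1 (hR r).1.
  move=> /h_inj; rewrite !mem_enum => /(_ (froots_froot _ _) (froots_froot _ _)) root_eq.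
  rewrite -(iter_cycle_label x q) -(iter_cycle_label x r) root_eq; congr iter.
  have := congr1 (findex y (h (froot x q))) qr; rewrite /X root_eq.
  rewrite !findex_iter // -?root_eq (hR q).2 ?label_lt //.
  by rewrite -(order_froot x q) root_eq order_froot label_lt.
exists (perm X_inj); apply/permP => r.
rewrite -[r](permKV (perm X_inj)); move: ((perm X_inj)^-1%g r) => q.
(* x raises the label by 1 modulo the length of the x-cycle. The matched y-cycle has the same
   length, so y may be iterated without the reduction. *)
rewrite permJ !permE /X (froot_iter x 1) (@cycle_label_iter _ x 1).
by rewrite -(hR q).2 iter_modn_order //; apply: perm_inj.
Qed.

End CycleType.

(** * Invariance under conjugation and averages over classes *)

Section ClassSums.
Variable n : nat.
Implicit Types (x y z g : 'S_n) (q : 'I_n).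

Lemma iter_conj x g k q : iter k (x ^ g)%g (g q) = g (iter k x q).
Proof. by elim: k => //= k ->; rewrite permJ. Qed.

Lemma porbit_conj x g q : porbit (x ^ g)%g (g q) = g @: porbit x q.
Proof.
apply/setP=> r; apply/porbitP/imsetP => [[k ->]|[_ /porbitP[k ->] ->]].
  by exists ((x ^+ k)%g q); rewrite ?mem_porbit // !permX iter_conj.
by exists k; rewrite !permX iter_conj.
Qed.

Lemma cycle_type_conj x g : cycle_type (x ^ g)%g = cycle_type x.
Proof.
have -> : cycle_type x = sort geq [seq #|pred_of_set c| | c <-
    [seq g @: c | c : {set 'I_n} <- enum (porbits x)]].
  rewrite /cycle_type -map_comp; congr sort; apply: eq_map => c /=.
  by rewrite card_imset //; apply: perm_inj.
have geq_total : total geq by move=> a b; apply: leq_total.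
have geq_trans : transitive geq by move=> a b c ab bc; apply: leq_trans bc ab.
have geq_anti : antisymmetric geq.
  by move=> a b ab; apply/eqP; rewrite eqn_leq andbC.
apply/(perm_sortP geq_total geq_trans geq_anti)/perm_map/uniq_perm.
- exact: enum_uniq.
- by rewrite map_inj_uniq ?enum_uniq //; apply/imset_inj/perm_inj.
move=> c; rewrite mem_enum; apply/imsetP/mapP => [[q _ ->]|[d]].
  exists (porbit x (g^-1%g q)); first by rewrite mem_enum imset_f.
  by rewrite -porbit_conj permKV.
by rewrite mem_enum => /imsetP[q _ ->] ->; exists (g q); rewrite ?porbit_conj.
Qed.

(** g carries x-cycles to y-cycles, though not roots to roots; since phi is constant on y-cycles,
    any representatives will do. *)
Lemma prod_froots_reindex (K : comNzRingType) x y g (phi : 'I_n -> K) :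
  (forall q, g (x q) = y (g q)) -> (forall q, phi (y q) = phi q) ->
  \prod_(q | froots y q) phi q = \prod_(q | froots x q) phi (g q).
Proof.
move=> xyg phi_y.
have froot_map (a b f : 'S_n) q : (forall r, f (a r) = b (f r)) ->
    froot b (f (froot a q)) = froot b (f q).
  move=> abf; rewrite -[in RHS](iter_cycle_label a q).
  have -> k r : f (iter k a r) = iter k b (f r) by elim: k => //= k <-.
  by rewrite froot_iter.
have yxg q : g^-1%g (y q) = x (g^-1%g q).
  by apply: (@perm_inj _ g); rewrite xyg !permKV.
rewrite (reindex_onto (fun q => froot y (g q)) (fun q => froot x (g^-1%g q))) => [|q /eqP qr].
  apply: eq_big => [q|q _].
    by rewrite froots_froot froot_map // permK.
  rewrite -[in RHS](iter_cycle_label y (g q)).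
  by elim: (cycle_label _ _) => //= k ->; rewrite phi_y.
by rewrite froot_map // permKV.
Qed.

Section LieWeight.
Variable zeta : nat -> algC.
Hypothesis zeta_prim : forall i, (0 < i)%N -> i.-primitive_root (zeta i).

(* The roots chosen by froot are not preserved by conjugation, but chi / chi_0
   is constant on the cycles of x for any two labellings chi and chi_0. *)
Lemma lie_weight_transversal x z (chi : 'I_n -> algC) :
  (forall q, chi q != 0) ->
  (forall q, chi (x q) = zeta (fingraph.order x q) * chi q) ->
  (forall q, x (z q) = z (x q)) ->
  lie_weight zeta x z = \prod_(q | froots x q) (chi (z q) / chi q).
Proof.
move=> chi0 chi_x xz; pose u q := chi q / cycle_char zeta x q.
have c0 q := cycle_char_neq0 zeta_prim x q.
have u_x q : u (x q) = u q.
  rewrite /u chi_x -[x q]/(iter 1 x q) cycle_char_iter // expr1 invfM.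
  rewrite mulrACA divff ?mul1r //; apply: contraTneq (fingraph.order_gt0 x q) => z0.
  have := zeta_prim (fingraph.order_gt0 x q) => /prim_expr_order; rewrite z0 => /eqP.
  by rewrite expr0n; case: fingraph.order => //= k; rewrite eq_sym oner_eq0.
have u0 : \prod_(q | froots x q) u q != 0.
  by apply/prodf_neq0 => q _; rewrite mulf_neq0 ?invr_eq0.
rewrite /lie_weight; apply: (mulfI u0).
(* z permutes the cycles of x and u is constant on them, so the product of u may be taken at the
   points z q instead. *)
rewrite {1}(@prod_froots_reindex _ x x z u) //.
rewrite -!big_split; apply: eq_bigr => q qr /=.
rewrite /u (cycle_char_root _ qr) invr1 mulr1 [RHS]mulrC divfK //.
suff -> : zeta (fingraph.order x q) ^+ lie_label x (z q) = cycle_char zeta x (z q).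
  by rewrite divfK.
by rewrite /cycle_char (order_comm (g := z)) //; apply: perm_inj.
Qed.

(** The potential of x^g pulled back along g is a potential for x, normalized at other base points;
    by [lie_weight_transversal] it computes the same weight. *)
Lemma lie_weightJ x z g : (forall q, x (z q) = z (x q)) ->
  lie_weight zeta (x ^ g)%g (z ^ g)%g = lie_weight zeta x z.
Proof.
move=> xz; set y := (x ^ g)%g; set w := (z ^ g)%g.
have yw q : y (w q) = w (y q).
  by rewrite -[q](permKV g) !permJ xz.
have c0 q := cycle_char_neq0 zeta_prim y q.
have c_y q : cycle_char zeta y (y q) = zeta (fingraph.order y q) * cycle_char zeta y q.
  by rewrite -[y q]/(iter 1 y q) cycle_char_iter.
have ord_w q : fingraph.order y (w q) = fingraph.order y q.
  by apply: order_comm; [apply: perm_inj | apply: perm_inj | apply: yw].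
have z0 q : zeta (fingraph.order y q) != 0.
  by have := c0 (y q); rewrite c_y mulf_eq0 => /norP[].
rewrite (@lie_weight_transversal y w (cycle_char zeta y)) //.
rewrite (@prod_froots_reindex _ x y g) => [|q|q]; last first.
- by rewrite -yw !c_y ord_w invfM mulrACA divff ?mul1r.
- by rewrite permJ.
rewrite (@lie_weight_transversal x z (fun q => cycle_char zeta y (g q))) //.
  by apply: eq_bigr => q _; rewrite permJ.
move=> q; rewrite -[in LHS]permJ c_y; congr (zeta _ * _).
rewrite /fingraph.order -(card_image (@perm_inj _ g) (fconnect x q)).
apply: eq_card => r; rewrite -[r](permKV g) mem_image; last exact: perm_inj.
apply/fconnect_iterP/fconnect_iterP => -[k kE]; exists k.
  by apply: (@perm_inj _ g); rewrite kE iter_conj.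
by rewrite kE iter_conj.
Qed.

End LieWeight.

Definition type_monom (V : comNzRingType) (v : nat -> V) x : V :=
  \prod_(q | froots x q) v (fingraph.order x q).

Lemma prod_exp_count (V : comNzRingType) (v : nat -> V) (m : nat) (l : seq nat) :
  (forall i, i \in l -> (0 < i <= m)%N) ->
  \prod_(1 <= i < m.+1) v i ^+ count_mem i l = \prod_(i <- l) v i.
Proof.
elim: l => [|a l IHl] l_lt; first by rewrite big_nil big1.
rewrite big_cons -IHl => [|i il]; last by apply: l_lt; rewrite inE il orbT.
under eq_bigr do rewrite /= exprD.
rewrite big_split /=; congr (_ * _).
rewrite (bigD1_seq a) ?iota_uniq ?mem_index_iota ?ltnS ?l_lt ?mem_head //=.
by rewrite eqxx expr1 big1 ?mulr1 // => i; rewrite eq_sym => /negPf ->.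
Qed.

Lemma prod_cycle_type (V : comNzRingType) (v : nat -> V) x :
  \prod_(i <- cycle_type x) v i = type_monom v x.
Proof. by rewrite (perm_big _ (cycle_type_froots x)) big_map big_enum. Qed.

Lemma part_monomE v (la : intpart n) x : cycle_type x = la ->
  part_monom v la = type_monom v x.
Proof.
move=> x_la; rewrite /part_monom prod_exp_count -?x_la ?prod_cycle_type //.
move=> i il; have /and3P[_ l0 /eqP ln] := cycle_typeP x; apply/andP; split.
  by rewrite lt0n; apply: contraNneq l0 => <-.
by rewrite -[leqRHS]ln sumnE (big_rem i) //= leq_addr.
Qed.

Lemma type_monomJ (V : comNzRingType) (v : nat -> V) x g :
  type_monom v (x ^ g)%g = type_monom v x.
Proof. by rewrite -!prod_cycle_type cycle_type_conj. Qed.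

(** The classes of S_n are indexed by cycle types, and that of [Y nu] has n!/|C(Y nu)| elements. *)
Lemma class_sum (V : lmodType algC) (H : 'S_n -> V) (Y : intpart n -> 'S_n) :
  (forall x g, H (x ^ g)%g = H x) -> (forall nu, cycle_type (Y nu) = nu) ->
  \sum_nu (#|'C[Y nu]%g|%:R)^-1 *: H (Y nu) = (n`!%:R)^-1 *: \sum_x H x.
Proof.
move=> HJ YP.
have /choice[ct ctP] x : exists la : intpart n, la = cycle_type x :> seq nat.
  exact/intpart_ex/cycle_typeP.
rewrite (partition_big ct xpredT) //= scaler_sumr; apply: eq_bigr => nu _.
have ctE x : (ct x == nu) = (x \in (Y nu) ^: [set: 'S_n])%g.
  apply/eqP/imsetP => [x_nu|[g _ ->]].
    have [|g ->] := @eq_cycle_type_conj n (Y nu) x; first by rewrite YP -ctP x_nu.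
    by exists g; rewrite ?inE.
  by apply: parts_inj; rewrite ctP cycle_type_conj YP.
rewrite (eq_bigr (fun=> H (Y nu))) => [|x]; last by rewrite ctE => /imsetP[g _ ->].
rewrite (eq_bigl _ _ ctE) sumr_const -index_cent1 -scaler_nat scalerA; congr (_ *: _).
have c0 : (#|'C[Y nu]%g|%:R : algC) != 0 by rewrite pnatr_eq0 -lt0n cardG_gt0.
apply: (mulfI c0); rewrite divff // mulrCA -natrM setTI Lagrange ?subsetT //.
by rewrite cardsT card_Sn mulVf // pnatr_eq0 -lt0n fact_gt0.
Qed.

Variable zeta : nat -> algC.
Hypothesis zeta_prim : forall i, (0 < i)%N -> i.-primitive_root (zeta i).
Variables (R : comAlgType algC) (s t : nat -> R).

Lemma lie_characterE x z :
  lie_character zeta_prim x z = lie_weight zeta x z *+ (z \in 'C[x]%g).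
Proof. exact: cfunElock. Qed.

(** Frobenius reciprocity against the class function [type_monom t], written out because its values
    lie in R. *)
Lemma higher_lie_sum x :
  (n`!%:R)^-1 *: \sum_y higher_lie zeta_prim x y *: type_monom t y =
  (#|'C[x]%g|%:R)^-1 *: \sum_(z in 'C[x]%g) lie_weight zeta x z *: type_monom t z.
Proof.
have n0 : (n`!%:R : algC) != 0 by rewrite pnatr_eq0 -lt0n fact_gt0.
apply: (scalerI n0); rewrite scalerA divff // scale1r.
transitivity (\sum_y \sum_(g : 'S_n) (#|'C[x]%g|%:R)^-1 *:
   (lie_character zeta_prim x (y ^ g)%g *: type_monom t (y ^ g)%g)).
  apply: eq_bigr => y _; rewrite /higher_lie cfIndE ?subsetT // -scalerA.
  rewrite scaler_suml scaler_sumr; apply: eq_big => [g|g _]; first by rewrite inE.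
  by rewrite type_monomJ.
rewrite exchange_big /=.
transitivity (\sum_(g : 'S_n) (#|'C[x]%g|%:R)^-1 *:
   \sum_(z in 'C[x]%g) lie_weight zeta x z *: type_monom t z).
  apply: eq_bigr => g _; rewrite -scaler_sumr; congr (_ *: _).
  transitivity (\sum_y lie_character zeta_prim x y *: type_monom t y).
    by rewrite [RHS](reindex_inj (conjg_inj g)).
  rewrite [RHS]big_mkcond; apply: eq_bigr => y _; rewrite lie_characterE.
  by case: (y \in _); rewrite ?mulr0n ?scale0r ?mulr1n.
by rewrite sumr_const card_Sn scaler_nat.
Qed.

(** The sum over nu is an average over S_n, and reciprocity turns it into an average over C(x la).
    This provides the factor 1/|C(x la)| that makes the sum over la an average over S_n in turn. *)
Lemma sum_higher_lie (x y : intpart n -> 'S_n)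
    (x_type : forall la, cycle_type (x la) = la)
    (y_type : forall nu, cycle_type (y nu) = nu) :
  \sum_(la : intpart n) \sum_(nu : intpart n)
    (higher_lie zeta_prim (x la) (y nu) / #|'C[y nu]%g|%:R) *:
      (type_monom s (x la) * type_monom t (y nu)) =
  (n`!%:R)^-1 *: pair_sum zeta s t [set: 'I_n].
Proof.
pose H z := \sum_(w in 'C[z]%g) lie_weight zeta z w *:
  (type_monom s z * type_monom t w).
transitivity ((n`!%:R)^-1 *: \sum_z H z); last first.
  congr (_ *: _); rewrite /H pair_big_dep /pair_sum; apply: eq_big => [[z w]|[z w] _] /=.
    apply/cent1P/commuting_pairsP => [zw|[_ _ /= zw]].
      by split=> [||q] /=; rewrite -?permM ?zw //; apply/subsetP => q; rewrite inE.
    by apply/permP => q; rewrite !permM zw.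
  rewrite /pair_weight (eq_bigl predT) => [|q]; last by rewrite inE.
  rewrite big_split -!big_mkcond /= scaler_prod -scalerAl; congr (_ *: _).
rewrite -(class_sum _ x_type); last first.
  move=> z g; rewrite /H (reindex_inj (conjg_inj g)).
  apply: eq_big => [w|w]; first by rewrite cent1J memJ_conjg.
  rewrite cent1J memJ_conjg => /cent1P zw; rewrite !type_monomJ lie_weightJ // => q.
  by rewrite -!permM zw.
apply: eq_bigr => la _.
transitivity (type_monom s (x la) * \sum_nu (#|'C[y nu]%g|%:R)^-1 *:
    (higher_lie zeta_prim (x la) (y nu) *: type_monom t (y nu))).
  rewrite mulr_sumr; apply: eq_bigr => nu _.
  by rewrite scalerA -scalerAr [(_ : algC) * _]mulrC.
rewrite (@class_sum _ (fun w => higher_lie zeta_prim (x la) w *: type_monom t w)) //.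
  rewrite higher_lie_sum -scalerAr mulr_sumr; congr (_ *: _).
  by apply: eq_bigr => z _; rewrite -scalerAr.
by move=> w g; rewrite type_monomJ cfunJ ?inE.
Qed.

End ClassSums.

(** * The logarithm of the generating series *)

Lemma fsum_pos_nat (K : zmodType) (F : nat -> K) (N : nat) :
  (forall i, (N < i)%N -> F i = 0) ->
  \sum_(i \in [set i : nat | (0 < i)%N]%classic) F i = \sum_(1 <= i < N.+1) F i.
Proof.
move=> F0; rewrite (fsbigE (index_iota 1 N.+1)) ?iota_uniq //.
- rewrite big_seq_cond [RHS]big_seq; apply: eq_bigl => i.
  by rewrite mem_index_iota; apply/andb_idr => /andP[i0 _]; rewrite mem_set.
- by move=> i /=; rewrite mem_index_iota => /andP[].
move=> i /= i0; rewrite mem_index_iota i0 /= ltnS -ltnNge; exact: F0.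
Qed.

Section ConnectedTerm.
Variables (zeta : nat -> algC) (R : comAlgType algC) (s t : nat -> R).
Hypothesis zeta_prim : forall i, (0 < i)%N -> i.-primitive_root (zeta i).

Lemma connected_termE m : (0 < m)%N -> connected_term zeta s t m =
  \sum_(i < m.+1 | (i %| m)%N) \sum_(e <- divisors i)
    (moebius e)%:~R *: (s i ^+ (m %/ i) * t (m %/ i * e)%N ^+ (i %/ e)).
Proof.
move=> m0; apply: eq_bigr => i im; have i0 : (0 < i)%N := dvdn_gt0 m0 im.
transitivity (\sum_(g <- divisors i) (moebius (i %/ g))%:~R *:
    (s i ^+ (m %/ i) * t (m %/ g)%N ^+ g)).
  transitivity (\sum_(g <- divisors i) \sum_(k < i | gcdn i k == g)
      zeta i ^+ k *: (s i ^+ (m %/ i) * t (m %/ g)%N ^+ g)).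
    rewrite sum_gcdn //; apply: eq_bigr => g _.
    by apply: eq_bigr => k /eqP ->.
  rewrite big_seq [RHS]big_seq; apply: eq_bigr => g; rewrite -dvdn_divisors // => gi.
  by rewrite -scaler_suml ramanujan_sum //; apply: zeta_prim.
rewrite -(perm_big _ (perm_div_divisors i0)) big_map big_seq [RHS]big_seq.
apply: eq_bigr => e; rewrite -dvdn_divisors // => ei; rewrite divnA // mulKn //.
by rewrite divnA // divn_mulAC.
Qed.

End ConnectedTerm.

(** * The grading by degree in the s_i *)

Section SWeight.
Local Notation X := (nat + nat)%type.
Implicit Types (m a b : {cmonom X}) (f g : fps X algC).

(* The degree in the s_i alone recovers n, so the t_j get weight 0. *)
Definition svar_weight (v : X) : nat := if v is inl i then i else 0%N.

Definition sweight m : nat := (\sum_(v <- finsupp m) m v * svar_weight v)%N.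

Lemma sweightE m (d : {fset X}) : (finsupp m `<=` d)%fset ->
  sweight m = (\sum_(v <- d) m v * svar_weight v)%N.
Proof.
move=> md; apply: big_fset_incl => // v _ vm.
by rewrite -cmE_eq0 in vm; rewrite (eqP vm).
Qed.

Lemma sweight1 : sweight mone = 0%N.
Proof. by rewrite /sweight mdom1 big_seq_fset0. Qed.

Lemma sweightM a b : sweight (mmul a b) = (sweight a + sweight b)%N.
Proof.
pose d := (finsupp (mmul a b) `|` (finsupp a `|` finsupp b))%fset.
rewrite !(@sweightE _ d) ?fsubsetUl //.
- by rewrite -big_split; apply: eq_bigr => v _; rewrite cmM mulnDl.
- by rewrite /d fsubsetU // fsubsetUr orbT.
- by rewrite /d fsubsetU // fsubsetUl orbT.
Qed.

Lemma sweightU v : sweight (ucm v) = svar_weight v.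
Proof.
rewrite (@sweightE _ [fset v]%fset) ?big_seq_fset1 ?ucmE ?eqxx ?mul1n //.
by apply/fsubsetP => w; rewrite inE -cmE_neq0 ucmE [w == v]eq_sym; case: (v == w).
Qed.

Definition homogeneous (n : nat) f := forall m, sweight m != n -> f m = 0.

Lemma homogeneousM n k f g : homogeneous n f -> homogeneous k g ->
  homogeneous (n + k)%N (f * g).
Proof.
move=> fn gk m mnk; rewrite fcoefM big_seq big1 // => p /mem_factorizations pm.
have [p1|/fn->] := eqVneq (sweight p.1) n; last by rewrite mul0r.
rewrite gk ?mulr0 //; apply: contraNneq mnk => p2.
by rewrite -pm sweightM p1 p2.
Qed.

Lemma homogeneousX n k f : homogeneous n f -> homogeneous (n * k)%N (f ^+ k).
Proof.
move=> fn; elim: k => [|k IHk]; last by rewrite exprS mulnS; apply: homogeneousM.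
rewrite muln0 expr0 => m m0; have -> : fcoef 1 m = (m == mone)%:R :> algC by [].
by case: (m =P mone) => [mE|//]; rewrite mE sweight1 eqxx in m0.
Qed.

Lemma homogeneous_var v : homogeneous (svar_weight v) (fps_var v).
Proof.
move=> m; rewrite /= -sweightU; by case: (eqVneq m (ucm v)) => // ->; rewrite eqxx.
Qed.

Lemma homogeneous_term i j k l :
  homogeneous (i * k)%N (s_ i ^+ k * t_ j ^+ l).
Proof.
rewrite -[(i * k)%N]addn0 -(mul0n l).
apply: homogeneousM; apply: homogeneousX.
  exact: (@homogeneous_var (inl i)).
exact: (@homogeneous_var (inr j)).
Qed.

Lemma fcoef_fps_sum (I : choiceType) (D : set I) (F : I -> fps X algC) m :
  fps_sum D F m = \sum_(i \in D) F i m.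
Proof. by []. Qed.

(** The exponent on the right-hand side of the theorem. *)
Definition commuting_log : fps X algC :=
  fps_sum [set i : nat | (0 < i)%N]%classic (fun i =>
    fps_sum [set j : nat | (0 < j)%N]%classic (fun j =>
      \sum_(e <- divisors (gcdn i j))
        ((moebius e)%:~R / (i%:R * j%:R / e%:R))
          *: (s_ i ^+ (j %/ e) * t_ j ^+ (i %/ e)))).

Lemma fcoef_term_eq0 m i j e : (i * (j %/ e) != sweight m)%N ->
  (s_ i ^+ (j %/ e) * t_ j ^+ (i %/ e)) m = 0.
Proof. by move=> ijm; apply: (@homogeneous_term i); rewrite eq_sym. Qed.

(** The degree i (j/e) = (i/e) j of a term is at least i and at least j, so only i and j up to the
    degree of m contribute. *)
Lemma commuting_log_sum m : commuting_log m =
  \sum_(1 <= i < (sweight m).+1) \sum_(1 <= j < (sweight m).+1)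
    (\sum_(e <- divisors (gcdn i j)) ((moebius e)%:~R / (i%:R * j%:R / e%:R))
        *: (s_ i ^+ (j %/ e) * t_ j ^+ (i %/ e))) m.
Proof.
set N := sweight m.
have big_index i j e : (0 < i)%N -> (0 < j)%N -> e \in divisors (gcdn i j) ->
    (N < i)%N || (N < j)%N -> (i * (j %/ e) != N)%N.
  move=> i0 j0; rewrite -dvdn_divisors ?gcdn_gt0 ?i0 // dvdn_gcd => /andP[ei ej].
  have le_j : (0 < j %/ e)%N by rewrite divn_gt0 ?(dvdn_gt0 i0) // dvdn_leq.
  have le_i : (0 < i %/ e)%N by rewrite divn_gt0 ?(dvdn_gt0 i0) // dvdn_leq.
  have ijE : (i * (j %/ e) = i %/ e * j)%N by rewrite muln_divA // divn_mulAC.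
  case/orP => lt_N; rewrite neq_ltn; apply/orP; right.
    by rewrite (leq_trans lt_N) // leq_pmulr.
  by rewrite ijE (leq_trans lt_N) // leq_pmull.
have coef0 i j : (0 < i)%N -> (0 < j)%N -> (N < i)%N || (N < j)%N ->
    (\sum_(e <- divisors (gcdn i j))
      ((moebius e)%:~R / (i%:R * j%:R / e%:R))
        *: (s_ i ^+ (j %/ e) * t_ j ^+ (i %/ e))) m = 0 :> algC.
  move=> i0 j0 ijN; rewrite fcoef_sum big_seq big1 // => e eij.
  by rewrite fcoefZ fcoef_term_eq0 ?mulr0 // (big_index i j).
rewrite fcoef_fps_sum (@fsum_pos_nat _ _ N) => [|i iN].
  apply: eq_big_nat => i /andP[i0 _].
  rewrite fcoef_fps_sum (@fsum_pos_nat _ _ N) // => j jN.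
  by rewrite coef0 ?jN ?orbT // (leq_ltn_trans _ jN).
rewrite fcoef_fps_sum fsbig1 // => j j0.
by rewrite coef0 ?iN // (leq_ltn_trans _ iN).
Qed.

Lemma commuting_log_coef m :
  (sweight m)%:R * commuting_log m =
  \sum_(1 <= i < (sweight m).+1) \sum_(1 <= j < (sweight m).+1)
    \sum_(e <- divisors (gcdn i j))
      (moebius e)%:~R * (s_ i ^+ (j %/ e) * t_ j ^+ (i %/ e)) m *+
        (i * (j %/ e) == sweight m)%N.
Proof.
rewrite commuting_log_sum; set N := sweight m.
rewrite mulr_sumr; apply: eq_big_nat => i /andP[i0 _].
rewrite mulr_sumr; apply: eq_big_nat => j /andP[j0 _].
rewrite fcoef_sum mulr_sumr big_seq [RHS]big_seq; apply: eq_bigr => e.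
rewrite -dvdn_divisors ?gcdn_gt0 ?i0 // dvdn_gcd => /andP[ei ej].
rewrite fcoefZ; have [ijN|/fcoef_term_eq0 ->] := eqVneq (i * (j %/ e))%N N; last by rewrite !mulr0.
have e0 : (e%:R : algC) != 0 by rewrite pnatr_eq0 -lt0n (dvdn_gt0 i0).
have -> : i%:R * j%:R / e%:R = N%:R :> algC.
  by rewrite -ijN -{1}(divnK ej) !natrM mulrA mulfK.
rewrite mulr1n mulrA; congr (_ * _); rewrite mulrCA divff ?mulr1 //.
rewrite pnatr_eq0 -lt0n -ijN muln_gt0 i0 divn_gt0 ?(dvdn_gt0 i0) //.
by rewrite dvdn_leq.
Qed.

(** For given i and e a single j contributes in degree N: i (j/e) = N forces i to divide N and j =
    (N/i) e, which gives the terms of [connected_termE]. *)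
Lemma euler_commuting_log zeta m :
  (forall i, (0 < i)%N -> i.-primitive_root (zeta i)) ->
  (sweight m)%:R * commuting_log m = connected_term zeta s_ t_ (sweight m) m.
Proof.
move=> zeta_prim; rewrite commuting_log_coef; set N := sweight m.
have [N0|N0] := posnP N; first by rewrite N0 big_geq // connected_term0.
rewrite connected_termE // fcoef_sum [RHS]big_mkcond.
pose G i := if (i %| N)%N then (\sum_(e <- divisors i)
    (moebius e)%:~R *: (s_ i ^+ (N %/ i) * t_ (N %/ i * e) ^+ (i %/ e))) m else 0.
have G0 : G 0%N = 0 by rewrite /G dvd0n gtn_eqF.
transitivity (\sum_(1 <= i < N.+1) G i); last first.
  by rewrite -(big_mkord xpredT G) [RHS]big_ltn // G0 Monoid.mul1m.
apply: eq_big_nat => i /andP[i0 iN]; rewrite /G.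
rewrite (eq_big_nat _ _ (F2 := fun j => \sum_(e <- divisors i | (e %| j)%N)
   (moebius e)%:~R * (s_ i ^+ (j %/ e) * t_ j ^+ (i %/ e)) m *+
        (i * (j %/ e) == N)%N)); last first.
  move=> j /andP[j0 _]; rewrite -[RHS]big_filter; apply: perm_big; apply: uniq_perm.
  - exact: divisors_uniq.
  - exact/filter_uniq/divisors_uniq.
  by move=> e; rewrite mem_filter -!dvdn_divisors ?gcdn_gt0 ?i0 // dvdn_gcd andbC.
rewrite (exchange_big_dep xpredT) //.
(* If i does not divide N, no term with this i has degree N. *)
case: ifP => iN_dvd; last first.
  rewrite big1 // => e _; rewrite big1 // => j ej; case: eqP => // jE.
  by rewrite -jE dvdn_mulr in iN_dvd.
rewrite fcoef_sum big_seq [RHS]big_seq; apply: eq_bigr => e.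
rewrite -dvdn_divisors // => ei; rewrite fcoefZ.
have e0 := dvdn_gt0 i0 ei; set a := (N %/ i)%N.
have a0 : (0 < a)%N by rewrite divn_gt0 // dvdn_leq.
have NE : N = (a * i)%N by rewrite divnK.
have aeN : (1 <= a * e < N.+1)%N.
  by rewrite muln_gt0 a0 e0 ltnS NE leq_pmul2l // dvdn_leq.
rewrite big_mkcond (bigD1_seq (a * e)%N) ?iota_uniq ?mem_index_iota //.
rewrite big1 => [|j]; last first.
  case: ifP => // /dvdnP[b ->]; rewrite mulnK // eqn_pmul2r // => ba.
  by rewrite [(i * b)%N]mulnC NE eqn_pmul2r // (negPf ba) mulr0n.
by rewrite Monoid.mulm1 dvdn_mull // mulnK // [(i * a)%N]mulnC -NE eqxx mulr1n.
Qed.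

Lemma homogeneous_connected_term zeta n :
  homogeneous n (connected_term zeta s_ t_ n).
Proof.
move=> m mn; rewrite fcoef_sum big1 // => i i_n.
rewrite fcoef_sum big1 // => k _; rewrite fcoefZ.
by rewrite (@homogeneous_term i) ?mulr0 // mulnC divnK.
Qed.

Lemma commuting_log0 m : sweight m = 0%N -> commuting_log m = 0.
Proof. by move=> m0; rewrite commuting_log_sum m0 big_geq. Qed.

End SWeight.

(** * Comparison of the two sides degree by degree *)

Theorem theorem3p1
    (zeta : nat -> algC)
    (zeta_prim : forall i, (0 < i)%N -> i.-primitive_root (zeta i))
    (x y : forall n, intpart n -> 'S_n)
    (x_type : forall n (la : intpart n), cycle_type (x n la) = la)
    (y_type : forall n (nu : intpart n), cycle_type (y n nu) = nu) :
  fps_sum [set: nat]%classic (fun n =>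
    \sum_(la : intpart n) \sum_(nu : intpart n)
      (higher_lie zeta_prim (x n la) (y n nu) / #|'C[y n nu]%g|%:R)
        *: (part_monom s_ la * part_monom t_ nu))
  = fps_exp
      (fps_sum [set i : nat | (0 < i)%N]%classic (fun i =>
       fps_sum [set j : nat | (0 < j)%N]%classic (fun j =>
         \sum_(e <- divisors (gcdn i j))
           ((moebius e)%:~R / (i%:R * j%:R / e%:R))
             *: (s_ i ^+ (j %/ e) * t_ j ^+ (i %/ e))))).
Proof.
(* The right-hand side is split into its homogeneous parts, to be matched with the summands on the
   left one n at a time. *)
rewrite -[RHS]/(fps_exp commuting_log) -[RHS](fps_sum_hom sweight).
congr (fps_sum _ _); apply/funext => n.
transitivity ((n`!%:R)^-1 *: pair_sum zeta s_ t_ [set: 'I_n]).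
  rewrite -(sum_higher_lie zeta_prim s_ t_ (x_type n) (y_type n)).
  apply: eq_bigr => la _; apply: eq_bigr => nu _.
  have E1 := part_monomE s_ (x_type n la).
  have E2 := part_monomE t_ (y_type n nu).
  congr (_ *: _).
  congr (_ * _).
    exact: E1.
  exact: E2.
(* The sequence a_n is taken to be the degree n part of the exponential; it remains to check a_0 = 1
   and the recurrence. *)
rewrite (@pair_sum_rec zeta _ s_ t_ zeta_prim _
  (fun k => fps_hom sweight k (fps_exp commuting_log))).
- rewrite cardsT card_ord scalerA mulVf ?scale1r //.
  by rewrite pnatr_eq0 -lt0n fact_gt0.
- exact: (fps_hom0_exp sweight1 sweightM commuting_log0).
move=> k; rewrite (fps_hom_exp sweight1 sweightM _ commuting_log0).
apply: eq_bigr => m _; congr (_ * _); apply/fpsP => mu.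
rewrite fps_homE fps_eulerE; have [<-|mu_m] := eqVneq (sweight mu) m.
  by rewrite mulr1n (euler_commuting_log _ zeta_prim).
by rewrite mulr0n (homogeneous_connected_term _ mu_m).
Qed.
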